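(* Let $k<n$ be coprime positive integers and $b=k/n$. Then every $F\in\mathfrak{F}$ has an attracting periodic orbit $\mathcal{O}$ of period $n$ such that: (i) the trajectories of Lebesgue almost every point of $\mathbb{R}$ converge to $\mathcal{O}$; (ii) $\mathcal{O}\subset[b-1,b]$ and every point of $\mathcal{O}$ lies in the first lap $(-\infty,y_-)$ or the third lap $(y_+,\infty)$ of $F$; (iii) $\mathcal{O}$ behaves like an orbit of $G$: if the endpoints $b-1$ and $b$ are identified to obtain a circle, the cyclic order of the points of $\mathcal{O}$ (in the order $z,F(z),\dots,F^{n-1}(z)$) is the same as that of an orbit of the rotation of this circle by $b$ (i.e. of the map $G$).
   Context: Fix coprime positive integers $k<n$ and set $b=k/n\in(0,1)$. Let $g\colon\mathbb{R}\to(0,1)$ be a $C^3$ map and $F\colon\mathbb{R}\to\mathbb{R}$, $F(x)=x+b-g(x)$. The class $\mathfrak{F}$ consists of all such $F$ for which the Schwarzian derivative $SF=\frac{F'''}{F'}-\frac32\left(\frac{F''}{F'}\right)^2$ is negative (wherever defined) and the following hold: (A) there exist $y_-,y_+$ with $b-1<y_-<0<y_+<b$ such that $0<g'(x)<1$ on $(-\infty,y_-)\cup(y_+,\infty)$, $g'(y_-)=g'(y_+)=1$, and $g'(x)>1$ on $(y_-,y_+)$; (B) $g(b-1)<b<g(b)$; (C) there exists $\varepsilon>0$ such that (C1) $g(x)<\varepsilon$ for all $x<-\frac1{2n}$; (C2) $g(x)>1-\varepsilon$ for all $x>\frac1{2n}$; (C3) $(n-1)\varepsilon<1-g(y_+)$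 and $(n-1)\varepsilon<\frac1{2n}-\big(1-g(y_+)+y_+\big)$; (C4) $(n-1)\varepsilon<g(y_-)$ and $(n-1)\varepsilon<\frac1{2n}-\big(g(y_-)-y_-\big)$. The first lap is $(-\infty,y_-]$ and the third lap is $[y_+,\infty)$. The map $G\colon\mathbb{R}\setminus\{0\}\to\mathbb{R}$ is $G(x)=x+b$ for $x<0$ and $G(x)=x+b-1$ for $x>0$; on $[b-1,b]$ with endpoints identified it is the rotation by $b$ (angle $2\pi b$). *)

(* Defs.v *)
From HB Require Import structures.
From mathcomp Require Import all_boot all_order all_algebra.
From mathcomp Require Import all_classical all_reals all_analysis.
Set Implicit Arguments. Unset Strict Implicit. Unset Printing Implicit Defensive.
Import Order.TTheory GRing.Theory Num.Theory.
Import numFieldNormedType.Exports.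
Local Open Scope classical_set_scope.
Local Open Scope ring_scope.

Section Defs.
Variable R : realType.

Definition C3 (g : R -> R) : Prop :=
  (forall x, [/\ derivable g x 1, derivable (derive1 g) x 1 & derivable (derive1n 2 g) x 1])
  /\ continuous (derive1n 3 g).

Definition Fmap (b : R) (g : R -> R) (x : R) : R := x + b - g x.

Definition schwarzian (f : R -> R) (x : R) : R :=
  derive1n 3 f x / derive1 f x - 3%:R / 2%:R * (derive1n 2 f x / derive1 f x) ^+ 2.

(* The map G: x+b for x<0, x+b-1 for x>0. At the (excluded) point 0 we set
   G 0 := b, which is the value of the rotation by b of the circle [b-1,b]/(b-1 ~ b). *)
Definition Gmap (b : R) (x : R) : R :=
  if x < 0 then x + b else if 0 < x then x + b - 1 else b.

(* Projection of [b-1,b] to the circle [b-1,b) obtained by identifying b with b-1 *)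
Definition circ (b : R) (x : R) : R := if x == b then b - 1 else x.

Definition ccw (x y z : R) : bool :=
  [|| (x < y) && (y < z), (y < z) && (z < x) | (z < x) && (x < y)].

Definition converges_to_orbit (f : R -> R) (z : R) (n : nat) (x : R) : Prop :=
  forall e : R, 0 < e ->
    \forall m \near \oo, exists j : nat, (j < n)%N /\ `|iter m f x - iter j f z| < e.

End Defs.

(* Main.v *)
Require Import Defs.
From HB Require Import structures.
From mathcomp Require Import all_boot all_order all_algebra.
From mathcomp Require Import all_classical all_reals all_analysis.
From mathcomp Require Import zify ring lra.
Set Implicit Arguments. Unset Strict Implicit. Unset Printing Implicit Defensive.
Import Order.TTheory GRing.Theory Num.Theory.
Import numFieldNormedType.Exports.
Local Open Scope classical_set_scope.
Local Open Scope ring_scope.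

(** Write [c+ = F y_+], [c- = F y_-] and place the grid [b - 1 + a/n] on [[b - 1, b]].
    Away from 0 the map is within [eps] of the rotation by [k/n], so condition (C) keeps the
    first [n] iterates of [c+] just above, and those of [c-] just below, the grid points.
    The [n] arcs running from an iterate of [c+] to the next iterate of [c-] avoid
    [[y_-, y_+]], are permuted by [F] like the cells of the rotation, and are strictly
    contracted; hence [F^n] has a fixed point on one of them, and it attracts all arcs.
    An orbit that eventually avoids [J = (y_-, y_+)] is driven into an arc by following the
    gaps between them.

    It remains to see that the points visiting [J] infinitely often form a null set.
    Negative Schwarzian derivative means that [|F'|^(-1/2)] is convex on each lap, which makes
    [F] expand cross-ratios there, a property stable under composition.  The critical orbits
    never come back to [J], so every visit of [x] to [J] at time [N] gives an interval around
    [x] that [F^N] maps monotonically onto the closure of [J].  Both ends of [J] escape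
    forever, and by the cross-ratio inequality their preimages fill a definite proportion of
    that interval.  Such intervals shrink to [x], so [x] is not a density point. *)

(** * Cross-ratios and the Schwarzian derivative *)

Section CrossRatio.
Context {R : realType}.

Definition expands_cross_ratio (f : R -> R) (a b : R) : Prop :=
  forall x1 x2 x3 x4, a <= x1 -> x1 < x2 -> x2 < x3 -> x3 < x4 -> x4 <= b ->
  (x3 - x1) * (x4 - x2) * ((f x2 - f x1) * (f x4 - f x3)) <=
  (f x3 - f x1) * (f x4 - f x2) * ((x2 - x1) * (x4 - x3)).

Lemma le_of_derive_ge0 (f df : R -> R) (a b : R) : a <= b ->
  (forall x, a <= x <= b -> is_derive x 1 f (df x)) ->
  (forall x, a <= x <= b -> 0 <= df x) -> f a <= f b.
Proof.
move=> ab fdf df0.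
have [||c] := @MVT_segment R f df a b ab.
- by move=> x; rewrite in_itv /= => /andP[ax xb]; apply: fdf; rewrite !ltW.
- apply: derivable_within_continuous => x; rewrite in_itv /= => xab.
  by have [] := fdf x xab.
rewrite in_itv /= => cab E; rewrite -subr_ge0 E mulr_ge0 ?subr_ge0 ?df0 //.
Qed.

Lemma is_derive_affine (p q c x : R) :
  is_derive x 1 (fun y => p + q * (y - c)) q.
Proof.
have D := is_deriveD (is_derive_cst (p - q * c) x 1) (is_deriveZ q (is_derive_id x 1)).
rewrite (_ : (fun y => _) = cst (p - q * c) + q \*: (@id R)).
  by apply: (is_derive_eq D); rewrite add0r /GRing.scale /= mulr1.
apply/funext => y; transitivity (p - q * c + q * y) => //; ring.
Qed.

End CrossRatio.

Section NegativeSchwarzian.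
Context {R : realType}.
Variables (a b : R) (f f1 f2 f3 : R -> R).
Hypothesis fD : forall x, a <= x <= b -> is_derive x 1 f (f1 x).
Hypothesis f1D : forall x, a <= x <= b -> is_derive x 1 f1 (f2 x).
Hypothesis f2D : forall x, a <= x <= b -> is_derive x 1 f2 (f3 x).
Hypothesis f1_gt0 : forall x, a <= x <= b -> 0 < f1 x.
Hypothesis Sf_le0 : forall x, a <= x <= b ->
  f3 x / f1 x - 3%:R / 2%:R * (f2 x / f1 x) ^+ 2 <= 0.

(* [h'' = - h S(f) / 2], so [h] is convex. *)
Let h (x : R) : R := (Num.sqrt (f1 x))^-1.
Let h1 (x : R) : R := - (f2 x / f1 x) * h x / 2.

Let h_gt0 x : a <= x <= b -> 0 < h x.
Proof. by move=> /f1_gt0 ?; rewrite invr_gt0 sqrtr_gt0. Qed.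

Let f1E x : a <= x <= b -> f1 x = (h x ^+ 2)^-1.
Proof. by move=> /f1_gt0 ?; rewrite exprVn invrK sqr_sqrtr // ltW. Qed.

Let hD x : a <= x <= b -> is_derive x 1 h (h1 x).
Proof.
move=> xab; have f1x := f1_gt0 xab.
have sx : 0 < Num.sqrt (f1 x) by rewrite sqrtr_gt0.
have D1 := f1D xab.
have D2 := is_derive1_sqrt f1x.
have D3 := @is_derive1_comp R Num.sqrt f1 x _ _ D2 D1.
have s0 : (Num.sqrt \o f1) x != 0 by rewrite gt_eqF.
have D4 := @is_deriveV R (Num.sqrt \o f1) x _ 1 s0 D3.
apply: (is_derive_eq D4).
move: sx (sqr_sqrtr (ltW f1x)); rewrite /h1 /h /GRing.scale /=.
by move: (Num.sqrt _) => s sx <-; field; rewrite gt_eqF.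
Qed.

Let h1_nondecreasing x y : a <= x -> x <= y -> y <= b -> h1 x <= h1 y.
Proof.
move=> ax xy yb.
apply: (@le_of_derive_ge0 _ _ (fun t => - (f3 t / f1 t - 3%:R / 2%:R * (f2 t / f1 t) ^+ 2) * h t / 2)) => // t /andP[xt ty].
  have tab : a <= t <= b by rewrite (le_trans ax xt) (le_trans ty yb).
  have D1 := f1D tab; have D2 := f2D tab; have D3 := hD tab.
  have f10 : f1 t != 0 by rewrite gt_eqF // f1_gt0.
  have D4 := @is_deriveV R f1 t _ 1 f10 D1.
  rewrite (_ : h1 = (f2 * (fun u => (f1 u)^-1)) * (h * cst (- 2^-1))); last first.
    by apply/funext => u; rewrite /h1 !fctE; ring.
  by apply: is_derive_eq; rewrite !fctE /h1 /GRing.scale /=; field.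
have tab : a <= t <= b by rewrite (le_trans ax xt) (le_trans ty yb).
by rewrite divr_ge0 // mulr_ge0 ?(ltW (h_gt0 _)) // oppr_ge0 Sf_le0.
Qed.

Let h_above_tangent c t : a <= c <= b -> a <= t <= b ->
  h c + h1 c * (t - c) <= h t.
Proof.
move=> cab tab.
pose d u := h u - h1 c * (u - c).
have dD u : a <= u <= b -> is_derive u 1 d (h1 u - h1 c).
  move=> uab; have D := hD uab.
  rewrite (_ : d = h - (cst (h1 c) * (id - cst c))) //.
  by apply: is_derive_eq; rewrite !fctE /GRing.scale /=; ring.
have [ct|tc] := leP c t.
  have : d c <= d t.
    apply: (@le_of_derive_ge0 _ _ (fun u => h1 u - h1 c)) => // u /andP[cu ut].
      by apply: dD; lra.
    by rewrite subr_ge0 h1_nondecreasing //; lra.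
  rewrite /d; lra.
have : - d t <= - d c.
  apply: (@le_of_derive_ge0 _ (- d) (fun u => - (h1 u - h1 c))) => //; first exact: ltW.
    move=> u /andP[tu uc]; have ? : is_derive u 1 d (h1 u - h1 c) by apply: dD; lra.
    exact: is_deriveN.
  by move=> u /andP[tu uc]; rewrite opprB subr_ge0 h1_nondecreasing //; lra.
rewrite /d; lra.
Qed.

(* Integrates [f' = h^-2 <= T^-2], where [T] is the tangent of [h] at [c]. *)
Let increment_le_tangent c t : a <= c <= b -> a <= t <= b ->
  0 < h c + h1 c * (t - c) ->
  (if c <= t then f t - f c <= (t - c) / (h c * (h c + h1 c * (t - c)))
   else f c - f t <= (c - t) / (h c * (h c + h1 c * (t - c)))).
Proof.
move=> cab tab T0; have hc := h_gt0 cab.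
pose T u := h c + h1 c * (u - c).
have T_gt0 u : Num.min c t <= u <= Num.max c t -> 0 < T u.
  rewrite /T; case: (leP c t) => ct /andP[cu ut].
    have [h10|h10] := leP 0 (h1 c); first by rewrite ltr_pwDl // mulr_ge0 ?subr_ge0.
    rewrite (lt_le_trans T0) // lerD2l ler_wnM2l ?(ltW h10) //; lra.
  have [h10|h10] := leP 0 (h1 c); last by rewrite ltr_pwDl // mulr_le0 ?(ltW h10) // subr_le0.
  rewrite (lt_le_trans T0) // lerD2l ler_wpM2l //; lra.
pose psi u := (u - c) * ((h c * T u)^-1) - f u.
have psiD u : a <= u <= b -> 0 < T u ->
    is_derive u 1 psi ((T u ^+ 2)^-1 - f1 u).
  move=> uab Tu; have Df := fD uab.
  have hT0 : h c * T u != 0 by rewrite gt_eqF // mulr_gt0.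
  have DT : is_derive u 1 (fun v => h c * T v) (h c * h1 c).
    rewrite (_ : (fun v => _) = fun v => h c * h c + h c * h1 c * (v - c)).
      exact: is_derive_affine.
    by apply/funext => v; rewrite /T; ring.
  have DV := @is_deriveV R (fun v => h c * T v) u _ 1 hT0 DT.
  rewrite (_ : psi = (id - cst c) * (fun v => (h c * T v)^-1) - f) //.
  apply: is_derive_eq; rewrite !fctE /GRing.scale /=.
  have E : h c = T u - h1 c * (u - c) by rewrite /T; ring.
  move: hT0; rewrite mulf_eq0 negb_or => /andP[hc0 T0'].
  congr (_ - _); apply/eqP; rewrite -subr_eq0; apply/eqP.
  transitivity ((T u - h1 c * (u - c) - h c) / (h c * T u ^+ 2)); first by field; rewrite ?hc0 ?T0'.
  by rewrite {1}/T addrK subrr mul0r.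
have psi_ge0 u : a <= u <= b -> 0 < T u -> 0 <= (T u ^+ 2)^-1 - f1 u.
  move=> uab Tu; rewrite subr_ge0 f1E // lef_pV2 ?posrE ?exprn_gt0 ?h_gt0 //.
  by rewrite ler_pXn2r ?nnegrE ?(ltW Tu) ?(ltW (h_gt0 _)) // h_above_tangent.
have seg u : Num.min c t <= u <= Num.max c t -> a <= u <= b.
  by case: (leP c t) => ct ?; lra.
have [ct|tc] := leP c t.
  have : psi c <= psi t.
    apply: (le_of_derive_ge0 (df := fun u => (T u ^+ 2)^-1 - f1 u)) => // u ut.
    - by apply: psiD; [apply: seg|apply: T_gt0]; rewrite min_l // max_r.
    - by apply: psi_ge0; [apply: seg|apply: T_gt0]; rewrite min_l // max_r.
  rewrite /psi subrr mul0r -/(T t); lra.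
have : psi t <= psi c.
  apply: (le_of_derive_ge0 (df := fun u => (T u ^+ 2)^-1 - f1 u)); first exact: ltW.
  - move=> u ut; apply: psiD; [apply: seg|apply: T_gt0]; rewrite min_r ?max_l // ltW //.
  - move=> u ut; apply: psi_ge0; [apply: seg|apply: T_gt0]; rewrite min_r ?max_l // ltW //.
rewrite /psi subrr mul0r -/(T t) -[c - t]opprB mulNr; lra.
Qed.

Let f_inc x y : a <= x -> x < y -> y <= b -> f x < f y.
Proof.
move=> ax xy yb.
have [||c] := @MVT R f f1 x y xy.
- by move=> u; rewrite in_itv /= => /andP[? ?]; apply: fD; lra.
- apply: derivable_within_continuous => u; rewrite in_itv /= => uxy.
  by have [] : is_derive u 1 f (f1 u) by apply: fD; lra.
rewrite in_itv /= => cab E; rewrite -subr_gt0 E mulr_gt0 ?subr_gt0 ?f1_gt0 //; lra.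
Qed.

(* The limit of the cross-ratio inequality when the two inner points merge into [c]. *)
Let derivative_ge x c y : a <= x -> x < c -> c < y -> y <= b ->
  (f c - f x) * (f y - f c) * (y - x) <= f1 c * (f y - f x) * ((c - x) * (y - c)).
Proof.
move=> ax xc cy yb.
have cab : a <= c <= b by lra.
have hc := h_gt0 cab.
have A0 : 0 < f c - f x by rewrite subr_gt0 f_inc //; lra.
have B0 : 0 < f y - f c by rewrite subr_gt0 f_inc //; lra.
set Tx := h c + h1 c * (x - c); set Ty := h c + h1 c * (y - c).
have HA : h c * Tx * (f c - f x) <= c - x.
  have [Tx0|Tx0] := ltP 0 Tx; last first.
    rewrite (@le_trans _ _ 0) //; last lra.
    by rewrite mulr_le0_ge0 ?(ltW A0) // mulr_ge0_le0 // ltW.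
  have xab : a <= x <= b by lra.
  have := increment_le_tangent cab xab Tx0; rewrite leNgt xc /= -/Tx.
  by rewrite ler_pdivlMr ?mulr_gt0 // mulrC.
have HB : h c * Ty * (f y - f c) <= y - c.
  have [Ty0|Ty0] := ltP 0 Ty; last first.
    rewrite (@le_trans _ _ 0) //; last lra.
    by rewrite mulr_le0_ge0 ?(ltW B0) // mulr_ge0_le0 // ltW.
  have yab : a <= y <= b by lra.
  have := increment_le_tangent cab yab Ty0; rewrite (ltW cy) /= -/Ty.
  by rewrite ler_pdivlMr ?mulr_gt0 // mulrC.
rewrite f1E // -[leRHS]mulrA [leRHS]mulrC ler_pdivlMr ?exprn_gt0 //.
have -> : (f c - f x) * (f y - f c) * (y - x) * h c ^+ 2 =
   (y - c) * (f y - f c) * (h c * Tx * (f c - f x)) +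
   (c - x) * (f c - f x) * (h c * Ty * (f y - f c)).
  by rewrite /Tx /Ty; ring.
have -> : (f y - f x) * ((c - x) * (y - c)) = (y - c) * (f y - f c) * (c - x) + (c - x) * (f c - f x) * (y - c) by ring.
by apply: lerD; apply: ler_wpM2l => //; rewrite mulr_ge0 ?(ltW A0) ?(ltW B0) //; lra.
Qed.

(* By [derivative_ge], the Moebius-normalized quotient [m] below is nondecreasing in the inner
   point. *)
Lemma schwarzian_le0_expands_cross_ratio : expands_cross_ratio f a b.
Proof.
move=> x1 x2 x3 x4 ax1 x12 x23 x34 x4b.
pose m c := ((f c - f x1) * (x4 - c)) * ((f x4 - f c) * (c - x1))^-1.
have pos c : x2 <= c <= x3 -> [/\ 0 < f c - f x1, 0 < f x4 - f c, 0 < x4 - c & 0 < c - x1].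
  by move=> ?; split; rewrite subr_gt0 ?f_inc //; lra.
have : m x2 <= m x3.
  apply: (le_of_derive_ge0 (df := fun c => (f1 c * (f x4 - f x1) * ((c - x1) * (x4 - c)) -
     (f c - f x1) * (f x4 - f c) * (x4 - x1)) / ((f x4 - f c) * (c - x1)) ^+ 2)).
  - exact: ltW.
  - move=> c cx; have [p1 p2 p3 p4] := pos c cx.
    have Df : is_derive c 1 f (f1 c) by apply: fD; lra.
    pose N := (f - cst (f x1)) * (cst x4 - id).
    pose D := (cst (f x4) - f) * (id - cst x1).
    have DD : is_derive c 1 D (f x4 - f c - f1 c * (c - x1)).
      by apply: is_derive_eq; rewrite !fctE /GRing.scale /=; ring.
    have n0 : D c != 0 by rewrite gt_eqF // mulr_gt0.
    have DV := @is_deriveV R D c _ 1 n0 DD.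
    rewrite (_ : m = N * (fun y => (D y)^-1)) //.
    apply: is_derive_eq; rewrite /N /D !fctE /GRing.scale /=.
    by field; rewrite (gt_eqF p2) (gt_eqF p4).
  - move=> c cx; have [p1 p2 p3 p4] := pos c cx.
    by rewrite divr_ge0 ?sqr_ge0 // subr_ge0 derivative_ge //; lra.
have [] := pos x2; first lra. 
move=> p1 p2 p3 p4.
have [] := pos x3; first lra. 
move=> q1 q2 q3 q4.
rewrite /m ler_pdivlMr ?mulr_gt0 // mulrAC ler_pdivrMr ?mulr_gt0 // => H.
by move: H; congr (_ <= _); ring.
Qed.

End NegativeSchwarzian.

Section CrossRatioComposition.
Context {R : realType}.
Implicit Types (f g : R -> R) (a b : R).

Lemma expands_cross_ratio_opp f a b :
  expands_cross_ratio (fun x => - f x) a b -> expands_cross_ratio f a b.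
Proof.
move=> E x1 x2 x3 x4 h1 h2 h3 h4 h5.
by have := E _ _ _ _ h1 h2 h3 h4 h5; congr (_ <= _); ring.
Qed.

Definition increasing_on f a b := forall x y, a <= x -> x < y -> y <= b -> f x < f y.
Definition decreasing_on f a b := forall x y, a <= x -> x < y -> y <= b -> f y < f x.

Let chain (u v U V w W : R) : 0 < u -> 0 < U -> 0 < v -> 0 < V -> 0 <= w ->
  u * V <= U * v -> U * w <= W * V -> u * w <= W * v.
Proof.
move=> u0 U0 v0 V0 w0 H1 H2.
rewrite -(ler_pM2r (mulr_gt0 U0 V0)).
have -> : u * w * (U * V) = (u * V) * (U * w) by ring.
have -> : W * v * (U * V) = (U * v) * (W * V) by ring.
by apply: ler_pM => //; rewrite mulr_ge0 // ltW.
Qed.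

Lemma expands_cross_ratio_comp_inc f g a b : increasing_on f a b ->
  increasing_on g (f a) (f b) \/ decreasing_on g (f a) (f b) ->
  expands_cross_ratio f a b -> expands_cross_ratio g (f a) (f b) ->
  expands_cross_ratio (g \o f) a b.
Proof.
move=> fi gm ef eg x1 x2 x3 x4 h1 h2 h3 h4 h5 /=.
have f12 : f x1 < f x2 by apply: fi => //; lra.
have f23 : f x2 < f x3 by apply: fi => //; lra.
have f34 : f x3 < f x4 by apply: fi => //; lra.
have fa : f a <= f x1.
  by move: h1; rewrite le_eqVlt => /predU1P[->//|ax]; apply/ltW/fi => //; lra.
have fb : f x4 <= f b.
  by move: h5; rewrite le_eqVlt => /predU1P[->//|ax]; apply/ltW/fi => //; lra.
have g0 : 0 <= (g (f x2) - g (f x1)) * (g (f x4) - g (f x3)).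
  case: gm => gm.
    by rewrite mulr_ge0 // subr_ge0 ltW // gm //; lra.
  by rewrite mulr_le0 // subr_le0 ltW // gm //; lra.
apply: (chain _ _ _ _ _ (ef _ _ _ _ h1 h2 h3 h4 h5) (eg _ _ _ _ fa f12 f23 f34 fb)) => //;
  rewrite mulr_gt0 // subr_gt0 //; lra.
Qed.

Lemma expands_cross_ratio_comp_dec f g a b : decreasing_on f a b ->
  increasing_on g (f b) (f a) \/ decreasing_on g (f b) (f a) ->
  expands_cross_ratio f a b -> expands_cross_ratio g (f b) (f a) ->
  expands_cross_ratio (g \o f) a b.
Proof.
move=> fi gm ef eg x1 x2 x3 x4 h1 h2 h3 h4 h5 /=.
have f12 : f x2 < f x1 by apply: fi => //; lra.
have f23 : f x3 < f x2 by apply: fi => //; lra.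
have f34 : f x4 < f x3 by apply: fi => //; lra.
have fa : f x1 <= f a.
  by move: h1; rewrite le_eqVlt => /predU1P[->//|ax]; apply/ltW/fi => //; lra.
have fb : f b <= f x4.
  by move: h5; rewrite le_eqVlt => /predU1P[->//|ax]; apply/ltW/fi => //; lra.
have g0 : 0 <= (g (f x2) - g (f x1)) * (g (f x4) - g (f x3)).
  case: gm => gm.
    by rewrite mulr_le0 // subr_le0 ltW // gm //; lra.
  by rewrite mulr_ge0 // subr_ge0 ltW // gm //; lra.
have H := eg _ _ _ _ fb f34 f23 f12 fa.
apply: (chain _ _ _ _ g0 (ef _ _ _ _ h1 h2 h3 h4 h5)).
- by rewrite mulr_gt0 // subr_gt0 //; lra.
- by rewrite nmulr_rgt0 subr_lt0 //; lra.
- by rewrite mulr_gt0 // subr_gt0 //; lra.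
- by rewrite nmulr_rgt0 subr_lt0 //; lra.
by move: H; congr (_ <= _); ring.
Qed.

End CrossRatioComposition.

(** * The set of points returning infinitely often is null *)

Section BimodalMaps.
Context {R : realType}.
Implicit Types (f : R -> R) (a b v x : R).

Lemma ivt_inc f a b v : continuous f -> a <= b -> f a <= v <= f b ->
  exists2 c, a <= c <= b & f c = v.
Proof.
move=> fc ab fab.
have [||c] := @IVT R f a b v ab.
- exact: continuous_subspaceT.
- by rewrite min_l ?max_r //; lra.
by rewrite in_itv /= => cab <-; exists c.
Qed.

Lemma ivt_dec f a b v : continuous f -> a <= b -> f b <= v <= f a ->
  exists2 c, a <= c <= b & f c = v.
Proof.
move=> fc ab fab.
have [||c] := @IVT R f a b v ab.
- exact: continuous_subspaceT.
- by rewrite min_r ?max_l //; lra.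
by rewrite in_itv /= => cab <-; exists c.
Qed.

Lemma continuous_iter f m : continuous f -> continuous (iter m f).
Proof.
move=> fc; elim: m => [x|m IH x]; first exact: cvg_id.
by rewrite (_ : iter m.+1 f = f \o iter m f) //; apply: continuous_comp; [exact: IH|exact: fc].
Qed.

Lemma increasing_on_le f a b x y : increasing_on f a b ->
  a <= x -> x <= y -> y <= b -> f x <= f y.
Proof.
by move=> fi ax; rewrite le_eqVlt => /predU1P[->//|xy] yb; apply/ltW/fi.
Qed.

Lemma decreasing_on_le f a b x y : decreasing_on f a b ->
  a <= x -> x <= y -> y <= b -> f y <= f x.
Proof.
by move=> fi ax; rewrite le_eqVlt => /predU1P[->//|xy] yb; apply/ltW/fi.
Qed.

Lemma ltr_anti_homo f a b : increasing_on f a b ->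
  forall x y, a <= x <= b -> a <= y <= b -> f x < f y -> x < y.
Proof.
move=> fi x y xab yab fxy; rewrite ltNge le_eqVlt; apply/negP => /predU1P[E|yx].
  by rewrite E ltxx in fxy.
have := fi y x; lra.
Qed.

Lemma ltr_anti_nhomo f a b : decreasing_on f a b ->
  forall x y, a <= x <= b -> a <= y <= b -> f x < f y -> y < x.
Proof.
move=> fi x y xab yab fxy; rewrite ltNge le_eqVlt; apply/negP => /predU1P[E|yx].
  by rewrite E ltxx in fxy.
have := fi x y; lra.
Qed.

End BimodalMaps.

Section NullSetOfRecurrentPoints.
Context {R : realType}.
Variables (F : R -> R) (y_m y_p u_m u_p : R).
Hypothesis F_cont : continuous F.
Hypothesis F_inc1 : forall x y, x < y -> y <= y_m -> F x < F y.
Hypothesis F_dec2 : forall x y, y_m <= x -> x < y -> y <= y_p -> F y < F x.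
Hypothesis F_inc3 : forall x y, y_p <= x -> x < y -> F x < F y.
Hypothesis F_ecr1 : forall a b, b < y_m -> expands_cross_ratio F a b.
Hypothesis F_ecr2 : forall a b, y_m < a -> b < y_p -> expands_cross_ratio F a b.
Hypothesis F_ecr3 : forall a b, y_p < a -> expands_cross_ratio F a b.
Hypothesis F_unbounded_below : forall x v, exists2 t, t <= x & F t <= v.
Hypothesis F_unbounded_above : forall x v, exists2 t, x <= t & v <= F t.
Hypotheses (ymum : y_m < u_m) (umup : u_m < u_p) (upyp : u_p < y_p).

Definition never_returns x :=
  forall j, (0 < j)%N -> ~ (y_m <= iter j F x <= y_p).

Hypothesis never_returns_left : forall x, y_m <= x <= u_m -> never_returns x.
Hypothesis never_returns_right : forall x, u_p <= x <= y_p -> never_returns x.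

Definition recurrent : set R :=
  [set x | forall m, exists2 j, (m <= j)%N & y_m < iter j F x < y_p].

Definition full_branch N p q :=
  [/\ p < q, expands_cross_ratio (iter N F) p q &
   [/\ increasing_on (iter N F) p q, iter N F p = y_m & iter N F q = y_p] \/
   [/\ decreasing_on (iter N F) p q, iter N F p = y_p & iter N F q = y_m]].

Lemma full_branch_range N p q t : full_branch N p q -> p <= t <= q -> y_m <= iter N F t <= y_p.
Proof.
case=> pq _ [] [mono Ep Eq] /andP[pt tq].
  by rewrite -{1}Ep -Eq !(increasing_on_le mono).
by rewrite -{1}Eq -Ep !(decreasing_on_le mono).
Qed.

Lemma full_branch_pullback_inc N p q a b : a < b -> increasing_on F a b ->
  expands_cross_ratio F a b -> F a = p -> F b = q -> full_branch N p q -> full_branch N.+1 a b.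
Proof.
move=> ab Fi FE <- <- [pq NE mono].
have E : iter N.+1 F = iter N F \o F by apply/funext => t; rewrite iterSr.
rewrite /full_branch E; split => //.
  by apply: expands_cross_ratio_comp_inc => //; case: mono => [][]; [left|right].
have Fm x y : a <= x -> x < y -> y <= b -> [/\ F a <= F x, F x < F y & F y <= F b].
  by move=> ax xy yb; split; [apply: (increasing_on_le Fi)|apply: Fi|apply: (increasing_on_le Fi)] => //; lra.
by case: mono => -[mono Ep Eq]; [left|right]; split => // x y ax xy yb /=;
  have [? ? ?] := Fm x y ax xy yb; apply: mono.
Qed.

Lemma full_branch_pullback_dec N p q a b : a < b -> decreasing_on F a b ->
  expands_cross_ratio F a b -> F a = q -> F b = p -> full_branch N p q -> full_branch N.+1 a b.
Proof.
move=> ab Fi FE <- <- [pq NE mono].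
have E : iter N.+1 F = iter N F \o F by apply/funext => t; rewrite iterSr.
rewrite /full_branch E; split => //.
  by apply: expands_cross_ratio_comp_dec => //; case: mono => [][]; [left|right].
have Fm x y : a <= x -> x < y -> y <= b -> [/\ F b <= F y, F y < F x & F x <= F a].
  by move=> ax xy yb; split; [apply: (decreasing_on_le Fi)|apply: Fi|apply: (decreasing_on_le Fi)] => //; lra.
by case: mono => -[mono Ep Eq]; [right|left]; split => // x y ax xy yb /=;
  have [? ? ?] := Fm x y ax xy yb; apply: mono.
Qed.

Let y_order : [/\ y_m < u_m, u_m < u_p & u_p < y_p]. Proof. by []. Qed.

Let never_ym : never_returns y_m.
Proof. by apply: never_returns_left; rewrite lexx ltW. Qed.

Let never_yp : never_returns y_p.
Proof. by apply: never_returns_right; rewrite lexx ltW. Qed.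

(* Pull [[y_m, y_p]] back along the orbit of [x].  Each pull-back stays inside the image of a
   lap because the critical values never return to [[y_m, y_p]]. *)
Lemma full_branch_at N x : y_m < iter N F x < y_p ->
  exists p q, [/\ p < x, x < q & full_branch N p q].
Proof.
elim: N x => [|N IH] x.
  have [? ? ?] := y_order.
  move=> /= xJ; exists y_m, y_p; split; [lra|lra|split; first lra].
    by move=> x1 x2 x3 x4 *; rewrite /= mulrC.
  by left; split.
move=> xJ; have [p [q [pFx Fxq G]]] : exists p q, [/\ p < F x, F x < q & full_branch N p q].
  by apply: IH; rewrite -iterSr.
have Nym : ~ (p <= F y_m <= q).
  by move=> /(full_branch_range G); rewrite -iterSr; exact: never_ym.
have Nyp : ~ (p <= F y_p <= q).
  by move=> /(full_branch_range G); rewrite -iterSr; exact: never_yp.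
have xym : x != y_m by apply/eqP => E; apply: Nym; rewrite -E; lra.
have xyp : x != y_p by apply/eqP => E; apply: Nyp; rewrite -E; lra.
have neqF s t (u v : R) : F s = u -> F t = v -> u < v -> s != t.
  by move=> <- <- uv; apply/eqP => E; rewrite E ltxx in uv.
have [xm|mx] := ltP x y_m.
  have Fxm := F_inc1 xm (lexx _).
  have qFm : q < F y_m by rewrite ltNge; apply/negP => ?; apply: Nym; lra.
  have [t tx Ftp] := F_unbounded_below x p.
  have [a atx Fa] : exists2 a, t <= a <= x & F a = p by apply: ivt_inc => //; lra.
  have [b bx Fb] : exists2 b, x <= b <= y_m & F b = q.
    by apply: ivt_inc => //; [exact: ltW|lra].
  have ax : a < x by rewrite lt_neqAle (neqF _ _ _ _ Fa erefl pFx); lra.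
  have xb : x < b by rewrite lt_neqAle (neqF _ _ _ _ erefl Fb Fxq); lra.
  have bm : b < y_m by rewrite lt_neqAle (neqF _ _ _ _ Fb erefl qFm); lra.
  exists a, b; split => //; apply: (@full_branch_pullback_inc _ p q) => //.
  - exact: lt_trans xb.
  - by move=> s s' ? ? ?; apply: F_inc1 => //; lra.
  - exact: F_ecr1.
have {}mx : y_m < x by rewrite lt_neqAle eq_sym xym.
have [xp|px] := ltP x y_p.
  have Fxm := F_dec2 (lexx _) mx (ltW xp).
  have Fxp := F_dec2 (ltW mx) xp (lexx _).
  have qFm : q < F y_m by rewrite ltNge; apply/negP => ?; apply: Nym; lra.
  have pFp : F y_p < p by rewrite ltNge; apply/negP => ?; apply: Nyp; lra.
  have [a atx Fa] : exists2 a, y_m <= a <= x & F a = q by apply: ivt_dec => //; lra.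
  have [b bx Fb] : exists2 b, x <= b <= y_p & F b = p by apply: ivt_dec => //; lra.
  have ax : a < x by rewrite lt_neqAle eq_sym (neqF _ _ _ _ erefl Fa Fxq); lra.
  have xb : x < b by rewrite lt_neqAle eq_sym (neqF _ _ _ _ Fb erefl pFx); lra.
  have bm : b < y_p by rewrite lt_neqAle eq_sym (neqF _ _ _ _ erefl Fb pFp); lra.
  have am : y_m < a by rewrite lt_neqAle eq_sym (neqF _ _ _ _ Fa erefl qFm); lra.
  exists a, b; split => //; apply: (@full_branch_pullback_dec _ p q) => //.
  - exact: lt_trans xb.
  - by move=> s s' ? ? ?; apply: F_dec2 => //; lra.
  - exact: F_ecr2.
have {}px : y_p < x by rewrite lt_neqAle eq_sym xyp.
have Fxp := F_inc3 (lexx _) px.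
have pFp : F y_p < p by rewrite ltNge; apply/negP => ?; apply: Nyp; lra.
have [t tx Ftp] := F_unbounded_above x q.
have [a atx Fa] : exists2 a, y_p <= a <= x & F a = p.
  by apply: ivt_inc => //; [exact: ltW|lra].
have [b bx Fb] : exists2 b, x <= b <= t & F b = q by apply: ivt_inc => //; lra.
have ax : a < x by rewrite lt_neqAle (neqF _ _ _ _ Fa erefl pFx); lra.
have xb : x < b by rewrite lt_neqAle (neqF _ _ _ _ erefl Fb Fxq); lra.
have am : y_p < a by rewrite lt_neqAle (neqF _ _ _ _ erefl Fa pFp); lra.
exists a, b; split => //; apply: (@full_branch_pullback_inc _ p q) => //.
- exact: lt_trans xb.
- by move=> s s' ? ? ?; apply: F_inc3 => //; lra.
- exact: F_ecr3.
Qed.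

Let s : R := (u_m - y_m) * (y_p - u_p).
Let S : R := (u_p - y_m) * (y_p - u_m).
Let rho : R := (S - s) / S.

Let S_gt0 : 0 < S. Proof. by have [? ? ?] := y_order; rewrite /S mulr_gt0 // subr_gt0; lra. Qed.
Let s_gt0 : 0 < s. Proof. by have [? ? ?] := y_order; rewrite /s mulr_gt0 // subr_gt0; lra. Qed.
Let s_lt_S : s < S. Proof. by have [? ? ?] := y_order; rewrite /s /S ltr_pM // ?subr_ge0; lra. Qed.

Let rho_lt1 : 0 < rho < 1.
Proof. by rewrite /rho divr_gt0 ?subr_gt0 //= ltr_pdivrMr // mul1r gtrBl. Qed.

Let middle_length l m r : 0 < l -> 0 < m -> 0 < r ->
  (l + m) * (m + r) * s <= S * (l * r) -> m <= rho * (l + m + r).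
Proof.
move=> l0 m0 r0 H; rewrite /rho mulrAC ler_pdivlMr //.
have SS := s_lt_S; have SP := S_gt0; have sP := s_gt0.
have lr : 0 < l * r by rewrite mulr_gt0.
have H2 : m * (l + m + r) * s <= (S - s) * (l * r).
  by rewrite -subr_ge0; move: H; rewrite -subr_ge0; congr (_ <= _); ring.
have H3 : (S - s) * (l * r) <= (S - s) * ((l + m + r) * (l + r)).
  apply: ler_wpM2l; first lra.
  by apply: ler_pM; lra.
have T0 : 0 < l + m + r by lra.
have H4 : m * s <= (S - s) * (l + r).
  rewrite -(ler_pM2l T0); apply: (le_trans _ (le_trans H3 _)).
    by apply: (le_trans _ H2); rewrite le_eqVlt; apply/orP; left; apply/eqP; ring.
  by rewrite le_eqVlt; apply/orP; left; apply/eqP; ring.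
have -> : m * S = m * s + (S - s) * m by ring.
have -> : (S - s) * (l + m + r) = (S - s) * (l + r) + (S - s) * m by ring.
by rewrite lerD2r.
Qed.

Lemma full_branch_middle N p q : full_branch N p q -> exists a b,
  [/\ p < a, a < b, b < q, b - a <= rho * (q - p) &
   forall t, p <= t <= a \/ b <= t <= q -> never_returns (iter N F t)].
Proof.
have [? ? ?] := y_order; move=> G; have GR := fun t => @full_branch_range N p q t G.
have cN := @continuous_iter R F N F_cont.
have pq : p < q by case: G.
have ppq : p <= p <= q by rewrite lexx ltW.
have qpq : p <= q <= q by rewrite lexx ltW.
case: G => _ ecr [] [mono Ep Eq].
- have [a apq Ea] : exists2 a, p <= a <= q & iter N F a = u_m.
    by apply: ivt_inc => //; rewrite ?Ep ?Eq ?ltW //; lra.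
  have [b bpq Eb] : exists2 b, p <= b <= q & iter N F b = u_p.
    by apply: ivt_inc => //; rewrite ?Ep ?Eq ?ltW //; lra.
  have pa : p < a by apply: (ltr_anti_homo mono) => //; rewrite Ep Ea.
  have ab : a < b by apply: (ltr_anti_homo mono) => //; rewrite Eb Ea.
  have bq : b < q by apply: (ltr_anti_homo mono) => //; rewrite Eq Eb.
  exists a, b; split => //.
    have := ecr p a b q (lexx _) pa ab bq (lexx _); rewrite Ep Eq Ea Eb => H.
    have -> : q - p = (a - p) + (b - a) + (q - b) by ring.
    apply: middle_length; rewrite ?subr_gt0 // /s /S.
    by move: H; congr (_ <= _); ring.
  move=> t [] tt.
    apply: never_returns_left; have := GR t; rewrite -Ea => H.
    apply/andP; split; first by have /andP[] : y_m <= iter N F t <= y_p by apply: H; lra.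
    move: tt => /andP[pt]; rewrite le_eqVlt => /predU1P[->//|ta].
    by apply/ltW/mono => //; lra.
  apply: never_returns_right; have := GR t; rewrite -Eb => H.
  apply/andP; split; last by have /andP[] : y_m <= iter N F t <= y_p by apply: H; lra.
  move: tt => /andP[+ tq]; rewrite le_eqVlt => /predU1P[->//|ta].
  by apply/ltW/mono => //; lra.
- have [b bpq Eb] : exists2 b, p <= b <= q & iter N F b = u_m.
    by apply: ivt_dec => //; rewrite ?Ep ?Eq ?ltW //; lra.
  have [a apq Ea] : exists2 a, p <= a <= q & iter N F a = u_p.
    by apply: ivt_dec => //; rewrite ?Ep ?Eq ?ltW //; lra.
  have pa : p < a by apply: (ltr_anti_nhomo mono) => //; rewrite Ep Ea.
  have ab : a < b by apply: (ltr_anti_nhomo mono) => //; rewrite Eb Ea.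
  have bq : b < q by apply: (ltr_anti_nhomo mono) => //; rewrite Eq Eb.
  exists a, b; split => //.
    have := ecr p a b q (lexx _) pa ab bq (lexx _); rewrite Ep Eq Ea Eb => H.
    have -> : q - p = (a - p) + (b - a) + (q - b) by ring.
    apply: middle_length; rewrite ?subr_gt0 // /s /S.
    by move: H; congr (_ <= _); ring.
  move=> t [] tt.
    apply: never_returns_right; have := GR t; rewrite -Ea => H.
    apply/andP; split; last by have /andP[] : y_m <= iter N F t <= y_p by apply: H; lra.
    move: tt => /andP[pt]; rewrite le_eqVlt => /predU1P[->//|ta].
    by apply/ltW/mono => //; lra.
  apply: never_returns_left; have := GR t; rewrite -Eb => H.
  apply/andP; split; first by have /andP[] : y_m <= iter N F t <= y_p by apply: H; lra.
  move: tt => /andP[+ tq]; rewrite le_eqVlt => /predU1P[->//|ta].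
  by apply/ltW/mono => //; lra.
Qed.

Lemma recurrent_not_never N x : recurrent x -> ~ never_returns (iter N F x).
Proof.
move=> rx nr; have [j Nj jJ] := rx N.+1.
apply: (nr (j - N)%N); first by rewrite subn_gt0.
by rewrite -iterD subnK ?(ltnW Nj) //; lra.
Qed.

Lemma full_branch_shrink N p q x : recurrent x -> full_branch N p q -> p < x < q ->
  exists N' p' q', [/\ full_branch N' p' q', p' < x < q' & q' - p' <= rho * (q - p)].
Proof.
move=> rx G xpq; have [a [b [pa ab bq len nev]]] := full_branch_middle G.
have [j Nj jJ] := rx N.+1.
have [p' [q' [px xq G']]] := full_branch_at jJ.
have nr t : never_returns (iter N F t) -> ~ (p' <= t <= q').
  move=> nt /(full_branch_range G'); rewrite -(subnK (ltnW Nj)) iterD; apply: nt.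
  by rewrite subn_gt0.
have ax : a < x.
  by rewrite ltNge; apply/negP => xa; apply: (recurrent_not_never (N := N) rx); apply: nev; left; lra.
have xb : x < b.
  by rewrite ltNge; apply/negP => xa; apply: (recurrent_not_never (N := N) rx); apply: nev; right; lra.
exists j, p', q'; split => //; first by rewrite px.
apply: le_trans len.
have ap : a <= p'.
  by rewrite leNgt; apply/negP => ?; apply: (nr a); [apply: nev; left; lra|lra].
have qb : q' <= b.
  by rewrite leNgt; apply/negP => ?; apply: (nr b); [apply: nev; right; lra|lra].
lra.
Qed.

Lemma full_branch_small x d : recurrent x -> 0 < d ->
  exists N p q, [/\ full_branch N p q, p < x < q & q - p < d].
Proof.
have rho01 := rho_lt1; move=> rx d0; have [j _ /full_branch_at[p [q [px xq G]]]] := rx 0%N.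
have [m Hm] : exists m, rho ^+ m * (q - p) < d.
  have /cvgr0Pnorm_lt/(_ (d / (q - p))) : (fun m => rho ^+ m) @ \oo --> 0.
    by apply: cvg_expr; rewrite ger0_norm; lra.
  have qp : 0 < q - p by lra.
  move=> /(_ (divr_gt0 d0 qp)) [m _ /(_ m (leqnn m))] /=.
  rewrite ger0_norm ?exprn_ge0 //; last lra.
  by rewrite ltr_pdivlMr // => ?; exists m.
suff [N' [p' [q' [G' x' l]]]] : exists N' p' q',
    [/\ full_branch N' p' q', p' < x < q' & q' - p' <= rho ^+ m * (q - p)].
  by exists N', p', q'; split => //; apply: le_lt_trans Hm.
elim: m {Hm} => [|m [N' [p' [q' [G' x' l]]]]].
  by exists j, p, q; rewrite px xq expr0 mul1r.
have [N2 [p2 [q2 [G2 x2 l2]]]] := full_branch_shrink rx G' x'.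
exists N2, p2, q2; split => //; apply: (le_trans l2).
by rewrite exprS -mulrA ler_wpM2l //; lra.
Qed.

Lemma measurable_recurrent : measurable recurrent.
Proof.
rewrite (_ : recurrent = \bigcap_m \bigcup_j (iter (m + j) F @^-1` `]y_m, y_p[)).
  apply: bigcapT_measurable => m; apply: bigcupT_measurable => j.
  apply: measurable_realfun.open_measurable; apply: open_comp; last exact: interval_open.
  by move=> x _; exact: continuous_iter.
apply/seteqP; split=> x /=.
  move=> rx m _; have [j mj jJ] := rx m.
  by exists (j - m)%N => //=; rewrite in_itv /= subnKC.
by move=> rx m; have [j _ /=] := rx m I; rewrite in_itv /= => H; exists (m + j)%N; rewrite ?leq_addr.
Qed.

Let density_le N p q x : full_branch N p q -> p < x < q ->
  (lebesgue_measure (recurrent `&` ball x (q - p)) *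
   (lebesgue_measure (ball x (q - p)))^-1 <= ((1 + rho) / 2)%:E)%E.
Proof.
move=> G xpq; have [a [b [pa ab bq len nev]]] := full_branch_middle G.
have l0 : 0 < q - p by lra.
rewrite lebesgue_measure_ball ?(ltW l0) // inver mulrn_eq0 /= gt_eqF //=.
rewrite lee_pdivrMr ?lte_fin ?mulrn_wgt0 // -EFinM.
pose I1 : set R := `[x - (q - p), p]%classic; pose I2 := `[a, b]%classic.
pose I3 := `[q, x + (q - p)]%classic.
apply: (@le_trans _ _ (lebesgue_measure (I1 `|` I2 `|` I3))).
  apply: le_measure; rewrite ?inE.
  - by apply: measurableI; [exact: measurable_recurrent|exact: measurable_realfun.measurable_ball].
  - by apply: measurableU; [apply: measurableU|]; exact: measurable_itv.
  move=> t [rt]; rewrite /ball /= ltr_distl => tb; rewrite /I1 /I2 /I3 /= !in_itv /=.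
  have [tp|pt] := leP t p; first by left; left; lra.
  have [qt|tq] := leP q t; first by right; lra.
  have nt := recurrent_not_never (N := N) rt.
  left; right; apply/andP; split; rewrite leNgt; apply/negP => ?; apply: nt; apply: nev; [left|right]; lra.
have U : (lebesgue_measure (I1 `|` I2 `|` I3) <=
    lebesgue_measure I1 + lebesgue_measure I2 + lebesgue_measure I3)%E.
  apply: (le_trans (measureU2 _ _ _)); first by apply: measurableU; exact: measurable_itv.
    exact: measurable_itv.
  by apply: leeD => //; apply: measureU2; exact: measurable_itv.
apply: (le_trans U); rewrite /I1 /I2 /I3 !lebesgue_measure_itv /= !lte_fin ab.
rewrite (_ : x - (q - p) < p); last lra.
rewrite (_ : q < x + (q - p)); last lra.
rewrite -!EFinB -!EFinD lee_fin.
have -> : (1 + rho) / 2 * ((q - p) *+ 2) = (q - p) + rho * (q - p) by field.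
by move: len; move: (rho * _) => y ?; lra.
Qed.

Lemma recurrent_negligible : (@lebesgue_measure R).-negligible recurrent.
Proof.
have rho01 := rho_lt1.
apply: negligibleS (lebesgue_density measurable_recurrent) => x rx /= dens.
have {}dens : (lebesgue_measure (recurrent `&` ball x r) *
   (lebesgue_measure (ball x r))^-1)%E @[r --> 0^'+] --> 1%E.
  by move: dens; rewrite indicE mem_set.
have th : (((1 + rho) / 2)%:E < 1 :> \bar R)%E by rewrite lte_fin; lra.
have := dens _ (open_ereal_gt' th); rewrite /= => -[d /= d0 Hd].
have [N [p [q [G xpq qpd]]]] := full_branch_small rx d0.
have := density_le G xpq; rewrite leNgt => /negP; apply.
apply: Hd; last lra.
by rewrite /= sub0r normrN gtr0_norm; lra.
Qed.

End NullSetOfRecurrentPoints.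

(** * Dynamics close to a rational rotation *)

Section RotationIndices.
Variables (k n : nat).
Hypotheses (k_gt0 : (0 < k)%N) (k_lt_n : (k < n)%N) (k_n : coprime k n).

(* The index [j < n] with [j * k = a] modulo [n]. *)
Definition rot_inv (a : nat) : nat := ((a * (egcdn k n).1) %% n)%N.

Let n_gt0 : (0 < n)%N. Proof. exact: leq_ltn_trans k_lt_n. Qed.

Let inv_k : (k * (egcdn k n).1 = 1 %[mod n])%N.
Proof.
case: (egcdnP n k_gt0) => km kn E _ /=.
by rewrite mulnC E (eqP k_n) modnMDl.
Qed.

Lemma rot_inv_lt a : (rot_inv a < n)%N.
Proof. by rewrite ltn_pmod. Qed.

Lemma rot_invK a : (a < n)%N -> ((rot_inv a * k) %% n = a)%N.
Proof.
move=> an; rewrite modnMml -mulnA (mulnC _ k) -modnMmr inv_k modnMmr muln1.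
exact: modn_small.
Qed.

Lemma rot_fwdK j : (j < n)%N -> rot_inv ((j * k) %% n) = j.
Proof.
move=> jn; rewrite /rot_inv modnMml -mulnA -modnMmr inv_k modnMmr muln1.
exact: modn_small.
Qed.

Lemma rot_inj i j : (i < n)%N -> (j < n)%N -> ((i * k) %% n = (j * k) %% n)%N -> i = j.
Proof. by move=> i_n j_n E; rewrite -(rot_fwdK i_n) E rot_fwdK. Qed.

Lemma rot_inv0 : rot_inv 0 = 0%N.
Proof. by rewrite /rot_inv mul0n mod0n. Qed.

Lemma rot_pred : ((n.-1 * k) %% n = n - k)%N.
Proof.
have E : (n.-1 * k = k.-1 * n + (n - k))%N.
  rewrite -!subn1 !mulnBl !mul1n (mulnC n k) addnBA ?(ltnW k_lt_n) //.
  by rewrite subnK // leq_pmull.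
by rewrite E modnMDl modn_small // ltn_subrL k_gt0.
Qed.

Lemma rot_inv_central : rot_inv (n - k) = n.-1.
Proof. by rewrite -rot_pred rot_fwdK // prednK. Qed.

Lemma rot_invS a : (a < n)%N -> (rot_inv a < n.-1)%N ->
  rot_inv ((a + k) %% n) = (rot_inv a).+1.
Proof.
move=> an H; rewrite -{1}(rot_invK an) modnDml -mulSnr rot_fwdK //.
by rewrite -(prednK n_gt0) ltnS.
Qed.

Lemma rot_inv_max a : (a < n)%N -> ~~ (rot_inv a < n.-1)%N -> a = (n - k)%N.
Proof.
move=> an; rewrite -leqNgt => H; rewrite -rot_pred -(rot_invK an); congr (_ * _ %% _)%N.
by apply/eqP; rewrite eqn_leq H andbT -ltnS prednK ?rot_inv_lt.
Qed.

Lemma rot_neq_central j : (j < n.-1)%N -> ((j * k) %% n != n - k)%N.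
Proof.
move=> jn; rewrite -rot_pred; apply/eqP => E.
have jn' : (j < n)%N by apply: leq_trans jn _; rewrite leq_pred.
have n1n : (n.-1 < n)%N by rewrite prednK.
by move: jn; rewrite (rot_inj jn' n1n E) ltnn.
Qed.

Lemma rot_neq0 j : (0 < j)%N -> (j < n)%N -> ((j * k) %% n != 0)%N.
Proof.
move=> j0 jn; apply/eqP => E; have := rot_inj jn n_gt0; rewrite E mul0n mod0n => /(_ erefl) E0.
by rewrite E0 in j0.
Qed.

End RotationIndices.

Section RotationLikeDynamics.
Context {R : realType}.
Variables (k n : nat) (F : R -> R) (y_m y_p e : R).
Hypotheses (k_gt0 : (0 < k)%N) (k_lt_n : (k < n)%N) (k_n : coprime k n).

Let nu : R := n%:R^-1.
Let h : R := nu / 2.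
Let b : R := k%:R / n%:R.
Let c_m : R := F y_m.
Let c_p : R := F y_p.

Hypothesis F_cont : continuous F.
Hypothesis F_left : forall x : R, x < - h -> x + b - e <= F x <= x + b.
Hypothesis F_right : forall x, h < x -> x + b - 1 <= F x <= x + b - 1 + e.
Hypotheses (e_gt0 : 0 < e) (ym_lt0 : y_m < 0) (yp_gt0 : 0 < y_p).
Hypothesis cp_bounds : b - 1 + y_p + n.-1%:R * e < c_p < b - 1 + h - n.-1%:R * e.
Hypothesis cm_bounds : b - h + n.-1%:R * e < c_m < b + y_m - n.-1%:R * e.
Hypothesis F_inc1 : forall x y, x < y -> y <= y_m -> F x < F y < F x + (y - x).
Hypothesis F_inc3 : forall x y, y_p <= x -> x < y -> F x < F y < F x + (y - x).

Let n_gt0 : (0 < n)%N. Proof. exact: leq_ltn_trans k_lt_n. Qed.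

Definition grid (a : nat) : R := b - 1 + a%:R * nu.

Let n_nu : n%:R * nu = 1. Proof. by rewrite mulfV // pnatr_eq0 -lt0n. Qed.
Let nu_gt0 : 0 < nu. Proof. by rewrite invr_gt0 ltr0n. Qed.
Let bE : b = k%:R * nu. Proof. by []. Qed.

Lemma grid_add a m : grid (a + m) = grid a + m%:R * nu.
Proof. by rewrite /grid natrD; ring. Qed.

Lemma gridS a : grid a.+1 = grid a + nu.
Proof. by rewrite -addn1 grid_add mul1r. Qed.

Lemma grid_central : grid (n - k) = 0.
Proof. by rewrite /grid natrB ?(ltnW k_lt_n) // mulrBl n_nu bE; ring. Qed.

Lemma grid_n : grid n = b.
Proof. by rewrite /grid n_nu; ring. Qed.

Lemma grid0 : grid 0 = b - 1.
Proof. by rewrite /grid mul0r addr0. Qed.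

Lemma grid_le a a' : (a <= a')%N -> grid a <= grid a'.
Proof. by move=> aa; rewrite /grid lerD2l ler_wpM2r ?(ltW nu_gt0) // ler_nat. Qed.

Lemma grid_left a : (a < n - k)%N -> grid a <= - nu.
Proof. by move=> /grid_le; rewrite gridS grid_central; lra. Qed.

Lemma grid_right a : (n - k < a)%N -> nu <= grid a.
Proof. by move=> /grid_le; rewrite gridS grid_central add0r. Qed.

Let numerics : [/\ 0 < h, nu = h + h, y_p < h, - h < y_m &
  [/\ e < h, 0 <= n.-1%:R * e, b <= 1 - nu, nu <= b & y_m < y_p]].
Proof.
have h0 : 0 < h by rewrite /h divr_gt0.
have nuE : nu = h + h by rewrite /h; field.
have n1e : e <= n.-1%:R * e.
  rewrite ler_peMl ?(ltW e_gt0) // ler1n -ltnS prednK //.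
  exact: leq_ltn_trans k_lt_n.
have b1 : b <= 1 - nu.
  by rewrite lerBrDr -n_nu bE -[X in _ + X <= _]mul1r -mulrDl natr1 ler_wpM2r ?(ltW nu_gt0) // ler_nat.
have b2 : nu <= b by rewrite bE ler_peMl ?(ltW nu_gt0) // ler1n.
have e0 := e_gt0; have ym0 := ym_lt0; have yp0 := yp_gt0.
have cp := cp_bounds; have cm := cm_bounds.
do !split => //; lra.
Qed.

Definition rot_step (a : nat) : nat := if (a < n - k)%N then (a + k)%N else (a + k - n)%N.

Lemma rot_step_mod a : (a < n)%N -> rot_step a = ((a + k) %% n)%N.
Proof.
move=> an; rewrite /rot_step ltn_subRL addnC; case: ltnP => H; first by rewrite modn_small.
rewrite -[in RHS](subnK H) modnDr modn_small // -(ltn_add2r n) subnK //.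
by have := k_lt_n; lia.
Qed.

Lemma grid_step_left a : (a < n - k)%N -> grid (rot_step a) = grid a + b.
Proof. by move=> H; rewrite /rot_step H grid_add. Qed.

Lemma grid_step_right a : (n - k <= a)%N -> grid (rot_step a) = grid a + b - 1.
Proof.
move=> H; rewrite /rot_step ltnNge H /= /grid natrB ?natrD; last by have := k_lt_n; lia.
by rewrite mulrBl n_nu mulrDl -bE; ring.
Qed.

Lemma track_step a d : a != (n - k)%N -> - h < d < h ->
  grid (rot_step a) + d - e <= F (grid a + d) <= grid (rot_step a) + d + e.
Proof.
have [h0 nuE ? ? [? ? ? ? ?]] := numerics; have e0 := e_gt0.
rewrite neq_ltn => /orP[] H dh.
  have g := grid_left H; rewrite grid_step_left //.
  have : grid a + d < - h by lra.
  by move=> /F_left; lra.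
have g := grid_right H; rewrite grid_step_right ?(ltnW H) //.
have : h < grid a + d by lra.
by move=> /F_right; lra.
Qed.

Lemma track_orbit a0 d0 : rot_step a0 = (k %% n)%N -> (a0 == 0%N) || (a0 == n) ->
  - h + n.-1%:R * e < d0 < h - n.-1%:R * e ->
  forall j, (j < n)%N ->
  let a := if j == 0%N then a0 else ((j * k) %% n)%N in
  grid a + d0 - j%:R * e <= iter j F (grid a0 + d0) <= grid a + d0 + j%:R * e.
Proof.
move=> Ha0 a0E dh; have [h0 nuE ? ? [? ? ? ? ?]] := numerics; have e0 := e_gt0.
elim=> [|j IH] jn; first by rewrite /= mul0r; lra.
have {IH} := IH (ltnW jn); set a := (if _ then _ else _) => /= IH.
have jn1 : (j < n.-1)%N by rewrite -ltnS prednK.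
have aC : a != (n - k)%N.
  rewrite /a; case: ifP => [_|_]; last exact: rot_neq_central.
  case/orP: a0E => /eqP ->; first by rewrite eq_sym -lt0n subn_gt0.
  by rewrite gtn_eqF // ltn_subrL k_gt0.
have aS : rot_step a = ((j.+1 * k) %% n)%N.
  rewrite /a; case: ifP => [/eqP ->|_]; first by rewrite mul1n.
  by rewrite rot_step_mod ?ltn_pmod // modnDml mulSnr.
have je : j%:R * e <= n.-1%:R * e by rewrite ler_pM2r // ler_nat ltnW.
have jSe : j.+1%:R * e = j%:R * e + e by rewrite mulrSr mulrDl mul1r.
rewrite /= jSe; move: IH; move: (iter j F _) => t IH.
have td : - h < t - grid a < h by lra.
have := track_step aC td; rewrite aS (_ : grid a + (t - grid a) = t); last by ring.
by move: (F t) => ft; lra.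
Qed.

Lemma cp_orbit j : (j < n)%N ->
  grid ((j * k) %% n) + y_p < iter j F c_p < grid ((j * k) %% n) + h.
Proof.
have [h0 nuE ? ? [? ? ? ? ?]] := numerics; have e0 := e_gt0.
have cp := cp_bounds; have yp0 := yp_gt0; move=> jn.
have a0 : rot_step 0 = (k %% n)%N by rewrite rot_step_mod.
have dh : - h + n.-1%:R * e < c_p - grid 0 < h - n.-1%:R * e by rewrite grid0; lra.
have := track_orbit a0 isT dh jn; rewrite /= subrKC.
have je : j%:R * e <= n.-1%:R * e.
  by rewrite ler_pM2r // ler_nat -ltnS prednK.
have -> : (if j == 0 then 0 else (j * k) %% n)%N = ((j * k) %% n)%N.
  by case: eqP => // ->; rewrite mul0n mod0n.
by move: (iter _ _ _) => t; rewrite grid0; lra.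
Qed.

(* As [rot_step 0 = rot_step n = k], the grid point [b] has index [n] for the orbit of [c_m],
   whereas [c_p] starts at index [0]. *)
Definition rot_up j : nat := if j == 0%N then n else ((j * k) %% n)%N.

Lemma cm_orbit j : (j < n)%N ->
  grid (rot_up j) - h < iter j F c_m < grid (rot_up j) + y_m.
Proof.
have [h0 nuE ? ? [? ? ? ? ?]] := numerics; have e0 := e_gt0.
have cm := cm_bounds; have ym0 := ym_lt0; move=> jn.
have a0 : rot_step n = (k %% n)%N.
  by rewrite /rot_step ltnNge leq_subr /= addKn modn_small.
have dh : - h + n.-1%:R * e < c_m - grid n < h - n.-1%:R * e by rewrite grid_n; lra.
have := track_orbit a0 (introT orP (or_intror (eqxx n))) dh jn; rewrite /= subrKC.
have je : j%:R * e <= n.-1%:R * e.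
  by rewrite ler_pM2r // ler_nat -ltnS prednK.
rewrite -/(rot_up j).
by move: (iter _ _ _) => t; rewrite grid_n; lra.
Qed.

(* The arc in the cell from [grid a] to [grid a.+1]; its left end is an iterate of [c_p], its
   right end an iterate of [c_m]. *)
Definition lo a : R := iter (rot_inv k n a) F c_p.
Definition hi a : R := iter (rot_inv k n (a.+1 %% n)) F c_m.
Definition arc a x := lo a <= x <= hi a.

Lemma lo_bounds a : (a < n)%N -> grid a + y_p < lo a < grid a + h.
Proof. by move=> an; have := cp_orbit (rot_inv_lt k_lt_n a); rewrite rot_invK. Qed.

Lemma hi_bounds a : (a < n)%N -> grid a.+1 - h < hi a < grid a.+1 + y_m.
Proof.
move=> an; have := cm_orbit (rot_inv_lt k_lt_n (a.+1 %% n)); rewrite -/(hi a).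
have -> // : rot_up (rot_inv k n (a.+1 %% n)) = a.+1.
rewrite /rot_up; have [E|N] := eqVneq a.+1 n.
  by rewrite E modnn rot_inv0.
have aSn : (a.+1 < n)%N by rewrite ltn_neqAle N.
rewrite modn_small // rot_invK //; case: eqP => // E.
by have := rot_invK k_gt0 k_n aSn; rewrite E mul0n mod0n.
Qed.

Lemma lo_lt_hi a : (a < n)%N -> lo a < hi a.
Proof.
have [? nuE ? ? [? ? ? ? ?]] := numerics.
by move=> an; have := lo_bounds an; have := hi_bounds an; rewrite gridS; lra.
Qed.

Lemma arc_lo a : (a < n)%N -> arc a (lo a).
Proof. by move=> an; rewrite /arc lexx ltW ?lo_lt_hi. Qed.

Lemma arc_hi a : (a < n)%N -> arc a (hi a).
Proof. by move=> an; rewrite /arc lexx andbT ltW ?lo_lt_hi. Qed.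

Lemma arc_left a x : (a < n - k)%N -> arc a x -> x < y_m.
Proof.
move=> ank; have an : (a < n)%N by apply: leq_trans ank _; rewrite leq_subr.
have := hi_bounds an; have := grid_le ank; rewrite grid_central /arc; lra.
Qed.

Lemma arc_right a x : (n - k <= a < n)%N -> arc a x -> y_p < x.
Proof.
move=> /andP[ank an].
have := lo_bounds an; have := grid_le ank; rewrite grid_central /arc; lra.
Qed.

Lemma arc_F a x y : (a < n)%N -> arc a x -> arc a y -> x < y ->
  F x < F y < F x + (y - x).
Proof.
move=> an ax ay xy; have [H|H] := ltnP a (n - k).
  by apply: F_inc1 => //; apply: ltW; exact: arc_left ay.
by apply: F_inc3 => //; apply: ltW; apply: (arc_right _ ax); rewrite H.
Qed.

Lemma arc_F_le a x y : (a < n)%N -> arc a x -> arc a y -> x <= y -> F x <= F y.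
Proof.
move=> an ax ay; rewrite le_eqVlt => /predU1P[->//|xy].
by have /andP[/ltW] := arc_F an ax ay xy.
Qed.

Lemma lo_step a : (a < n)%N -> lo ((a + k) %% n) <= F (lo a).
Proof.
move=> an; have [H|H] := boolP (rot_inv k n a < n.-1)%N.
  by rewrite /lo rot_invS.
have aE := rot_inv_max k_gt0 k_lt_n k_n an H.
rewrite {1}/lo aE subnK ?(ltnW k_lt_n) // modnn rot_inv0 /=.
have L : y_p < lo (n - k).
  apply: (@arc_right (n - k)); first by rewrite leqnn ltn_subrL k_gt0.
  by apply: arc_lo; rewrite ltn_subrL k_gt0.
by have /andP[/ltW] := F_inc3 (lexx _) L.
Qed.

Lemma hi_step a : (a < n)%N -> F (hi a) <= hi ((a + k) %% n).
Proof.
move=> an; have aSn : (a.+1 %% n < n)%N by rewrite ltn_pmod.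
have E : (((a + k) %% n).+1 %% n = (a.+1 %% n + k) %% n)%N.
  by rewrite -addn1 modnDml modnDml addn1 addSn.
have [H|H] := boolP (rot_inv k n (a.+1 %% n) < n.-1)%N.
  by rewrite /hi E rot_invS.
have aE := rot_inv_max k_gt0 k_lt_n k_n aSn H.
rewrite [leRHS]/hi E aE subnK ?(ltnW k_lt_n) // modnn rot_inv0 /=.
have L : hi a < y_m.
  apply: (@arc_left a); last exact: arc_hi.
  move: aE; have [E'|N] := eqVneq a.+1 n.
    by rewrite E' modnn => /esym/eqP; rewrite subn_eq0 leqNgt k_lt_n.
  by have aS : (a.+1 < n)%N; [rewrite ltn_neqAle N|rewrite modn_small // => <-].
by have /andP[/ltW] := F_inc1 L (lexx _).
Qed.

Lemma arc_step a x : (a < n)%N -> arc a x -> arc ((a + k) %% n) (F x).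
Proof.
move=> an ax; have /andP[lx xh] := ax; rewrite /arc.
apply/andP; split.
  by apply: le_trans (lo_step an) _; apply: (arc_F_le an) => //; exact: arc_lo.
by apply: le_trans (hi_step an); apply: (arc_F_le an) => //; exact: arc_hi.
Qed.

Lemma arc_iter a x m : (a < n)%N -> arc a x -> arc ((a + m * k) %% n) (iter m F x).
Proof.
move=> an ax; elim: m => [|m IH]; first by rewrite mul0n addn0 modn_small.
by rewrite /= mulSnr addnA -modnDml; apply: arc_step; rewrite ?ltn_pmod.
Qed.

Lemma arc_convex a x y t : arc a x -> arc a y -> x <= t <= y -> arc a t.
Proof. rewrite /arc; lra. Qed.

Lemma arc_contract a x y m : (a < n)%N -> arc a x -> arc a y -> x < y ->
  [/\ iter m F x < iter m F y, iter m F y <= iter m F x + (y - x) &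
   (0 < m)%N -> iter m F y < iter m F x + (y - x)].
Proof.
move=> an ax ay xy; elim: m => [|m [IH1 IH2 _]]; first by split => //=; lra.
have := arc_F _ (arc_iter m an ax) (arc_iter m an ay); rewrite ltn_pmod // => /(_ isT IH1) /=.
by move: IH2; move: (iter m F x) (iter m F y) => s t ? ?; split => [||_]; lra.
Qed.

Lemma arc_avoids a x j : (a < n)%N -> arc a x -> ~ (y_m <= iter j F x <= y_p).
Proof.
move=> an /(arc_iter j an); set a' := (_ %% n)%N => H.
have a'n : (a' < n)%N by rewrite ltn_pmod.
have [L|L] := ltnP a' (n - k).
  by have := arc_left L H; lra.
by have := @arc_right a' _ _ H; rewrite L a'n => /(_ isT); lra.
Qed.

Let nk_lt_n : (n - k < n)%N. Proof. by rewrite ltn_subrL k_gt0. Qed.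

Let arc_iter_n x : arc (n - k) x -> arc (n - k) (iter n F x).
Proof. by move=> /(arc_iter n nk_lt_n); rewrite addnC (mulnC n) modnMDl modn_small. Qed.

Lemma exists_periodic : exists2 z, arc (n - k) z & iter n F z = z.
Proof.
have lh := lo_lt_hi nk_lt_n.
have := arc_iter_n (arc_lo nk_lt_n); have := arc_iter_n (arc_hi nk_lt_n).
rewrite /arc => Hh Hl.
have cont : continuous (fun x => iter n F x - x).
  by move=> x; apply: cvgB; [exact: continuous_iter|exact: cvg_id].
have lh0 : iter n F (hi (n - k)) - hi (n - k) <= 0 <= iter n F (lo (n - k)) - lo (n - k) by lra.
have [z zlh Ez] := ivt_dec cont (ltW lh) lh0.
by exists z; [exact: zlh|lra].
Qed.

Lemma converges_to_orbit_iter z x m :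
  converges_to_orbit F z n (iter m F x) -> converges_to_orbit F z n x.
Proof.
move=> H d d0; have [q _ Hq] := H d d0.
exists (q + m)%N => // l /= ql.
have /Hq : (q <= l - m)%N by rewrite leq_subRL ?(leq_trans _ ql) ?leq_addl // addnC.
by rewrite /= -iterD subnK // (leq_trans _ ql) // leq_addl.
Qed.

Lemma iter_mod_period z m : iter n F z = z -> iter m F z = iter (m %% n) F z.
Proof.
move=> Hz; rewrite {1}(divn_eq m n) addnC iterD; congr (iter _ _ _).
by elim: (m %/ n)%N => [|q IH]; rewrite ?mul0n // mulSn iterD IH.
Qed.

Lemma arc_contract_norm a x y m : (a < n)%N -> arc a x -> arc a y ->
  `|iter m F x - iter m F y| <= `|x - y|.
Proof.
move=> an ax ay; have [xy|yx|->] := ltgtP x y; last by rewrite !subrr.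
  have [? ? _] := arc_contract m an ax ay xy.
  by rewrite !ltr0_norm ?subr_lt0 //; lra.
have [? ? _] := arc_contract m an ay ax yx.
by rewrite !gtr0_norm ?subr_gt0 //; lra.
Qed.

Lemma arc_contract_strict x y : arc (n - k) x -> arc (n - k) y -> x != y ->
  `|iter n F x - iter n F y| < `|x - y|.
Proof.
move=> ax ay xNy; have [xy|yx|E] := ltgtP x y; last by rewrite E eqxx in xNy.
  have [? ? H] := arc_contract n nk_lt_n ax ay xy.
  by have := H n_gt0; rewrite !ltr0_norm ?subr_lt0 //; lra.
have [? ? H] := arc_contract n nk_lt_n ay ax yx.
by have := H n_gt0; rewrite !gtr0_norm ?subr_gt0 //; lra.
Qed.

Lemma arc_iter_le x y m : arc (n - k) x -> arc (n - k) y -> x <= y -> iter m F x <= iter m F y.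
Proof.
move=> ax ay; rewrite le_eqVlt => /predU1P[->//|xy].
by have [/ltW] := arc_contract m nk_lt_n ax ay xy.
Qed.

Lemma arc_cvg (z x d : R) : arc (n - k) z -> iter n F z = z -> arc (n - k) x -> 0 < d ->
  exists q, `|iter (q * n) F x - z| < d.
Proof.
move=> az Hz ax d0.
have zq q : iter (q * n) F z = z by rewrite iter_mod_period // modnMl.
have aq q : arc (n - k) (iter (q * n) F x).
  by elim: q => [//|q IH]; rewrite mulSn iterD; exact: arc_iter_n.
pose u q := iter (q * n) F x.
pose D q := `|u q - z|.
have D_dec : nonincreasing_seq D.
  apply/nonincreasing_seqP => q; rewrite /D /u mulSn iterD -{1}Hz.
  exact: arc_contract_norm nk_lt_n _ _.
have D_lb : has_lbound (range D) by exists 0 => _ [q _ <-]; rewrite /D normr_ge0.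
have D_cvg := nonincreasing_is_cvgn D_dec D_lb.
pose sg : R := if x <= z then -1 else 1.
have uE q : u q = z + sg * D q.
  rewrite /sg /D /u; have [xz|zx] := leP x z.
    have := arc_iter_le (q * n) ax az xz; rewrite zq => H.
    by rewrite ler0_norm ?subr_le0 //; ring.
  have := arc_iter_le (q * n) az ax (ltW zx); rewrite zq => H.
  by rewrite ger0_norm ?subr_ge0 //; ring.
pose l : R := z + sg * limn D.
have u_cvg : u @ \oo --> l.
  rewrite (_ : u = fun q => z + sg * D q); last exact/funext.
  by apply: cvgD; [exact: cvg_cst|apply: cvgMr].
have l_fix : iter n F l = l.
  have H1 : (fun q => iter n F (u q)) @ \oo --> iter n F l.
    by apply: continuous_cvg => //; exact: continuous_iter.
  have H2 : (fun q => u (q + 1)%N) @ \oo --> l by have := u_cvg; rewrite -(cvg_shiftn 1).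
  have E : (fun q => iter n F (u q)) = (fun q => u (q + 1)%N).
    by apply/funext => q; rewrite /u addn1 mulSn iterD.
  by rewrite E in H1; exact: (cvg_unique _ H1 H2).
have l_arc : arc (n - k) l.
  have d_ge0 : 0 <= limn D by apply: limr_ge => //; apply: nearW => q; exact: normr_ge0.
  have d_le : limn D <= D 0%N by exact: nonincreasing_cvgn_ge.
  have := uE 0%N; rewrite /u mul0n /= => xE; move: xE; rewrite /l /sg.
  have [xz|zx] := leP x z => xE.
    by apply: (arc_convex ax az); lra.
  by apply: (arc_convex az ax); lra.
have lz : l = z.
  apply/eqP; apply/negPn/negP => lz.
  by have := arc_contract_strict l_arc az lz; rewrite l_fix Hz ltxx.
have /cvgrPdist_lt /(_ d d0) [q _ Hq] := u_cvg.
by exists q; have := Hq q (leqnn q); rewrite /= lz distrC.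
Qed.

Lemma arc_converges z a x : arc (n - k) z -> iter n F z = z -> (a < n)%N -> arc a x ->
  converges_to_orbit F z n x.
Proof.
move=> az Hz an ax.
pose m := (n.-1 - rot_inv k n a)%N.
have am : arc (n - k) (iter m F x).
  rewrite (_ : (n - k = (a + m * k) %% n)%N); first exact: arc_iter.
  rewrite -{1}(rot_invK k_gt0 k_n an) modnDml -mulnDl /m subnKC ?rot_pred //.
  by rewrite -ltnS prednK // rot_inv_lt.
apply: (@converges_to_orbit_iter _ _ m) => d d0.
have [q Hq] := arc_cvg az Hz am d0.
exists (q * n)%N => // l /= ql; exists ((l - q * n) %% n)%N; split; first by rewrite ltn_pmod.
rewrite -iter_mod_period // -{1}(subnK ql) iterD; apply: le_lt_trans Hq.
apply: (arc_contract_norm _ nk_lt_n) => //.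
by have := arc_iter (q * n) nk_lt_n am; rewrite addnC mulnAC modnMDl modn_small.
Qed.

Lemma orbit_enters_core x : exists m, c_p <= iter m F x <= c_m.
Proof.
have [h0 nuE ? ? [? ? ? ? ?]] := numerics; have e0 := e_gt0.
have cp := cp_bounds; have cm := cm_bounds; have ym0 := ym_lt0; have yp0 := yp_gt0.
have down q t : c_p <= t -> t <= c_m + q%:R * h -> exists m, c_p <= iter m F t <= c_m.
  elim: q t => [|q IH] t ct tq; first by exists 0%N; rewrite ct /=; lra.
  have [tc|tc] := leP t c_m; first by exists 0%N; rewrite ct.
  have th : h < t by lra.
  have Ft := F_right th.
  have yt : y_p < t by lra.
  have := F_inc3 (lexx _) yt; rewrite -/c_p => Fp.
  have [||m] := IH (F t); [lra| |by rewrite -iterSr => ?; exists m.+1].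
  by move: tq; rewrite mulrSr mulrDl mul1r; lra.
have up q t : t <= c_m -> c_p - q%:R * h <= t -> exists m, c_p <= iter m F t <= c_m.
  elim: q t => [|q IH] t ct tq; first by exists 0%N; rewrite /=; lra.
  have [tc|tc] := leP c_p t; first by exists 0%N; rewrite tc.
  have th : t < - h by lra.
  have Ft := F_left th.
  have yt : t < y_m by lra.
  have := F_inc1 yt (lexx _); rewrite -/c_m => Fp.
  have [||m] := IH (F t); [lra| |by rewrite -iterSr => ?; exists m.+1].
  by move: tq; rewrite mulrSr mulrDl mul1r; lra.
have [cx|xc] := leP c_p x.
  have [q Hq] : exists q : nat, (x - c_m) / h < q%:R.
    by exists (Num.bound `|(x - c_m) / h|); exact: le_lt_trans (ler_norm _) (archi_boundP (normr_ge0 _)).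
  by apply: (down q) => //; move: Hq; rewrite ltr_pdivrMr //; lra.
have [q' Hq] : exists q : nat, (c_p - x) / h < q%:R.
  by exists (Num.bound `|(c_p - x) / h|); exact: le_lt_trans (ler_norm _) (archi_boundP (normr_ge0 _)).
by apply: (up q') => //; [lra|move: Hq; rewrite ltr_pdivrMr //; lra].
Qed.

Definition avoids y := forall j, ~ (y_m < iter j F y < y_p).

(* The gap between [iter j F c_m] and [iter j F c_p] surrounds a grid point and is carried
   monotonically to the gap around 0, which consists of [J] and two pieces mapped into arcs. *)
Lemma gap_enters_arc j y : (0 < j)%N -> (j < n)%N -> avoids y ->
  iter j F c_m <= y <= iter j F c_p ->
  exists m a, (a < n)%N /\ arc a (iter m F y).
Proof.
have [h0 nuE ? ? [? ? ? ? ?]] := numerics.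
move=> j0 jn; have [d] := ubnP (n - j)%N; elim: d j y j0 jn => // d IH j y j0 jn jd av yj.
have M := cm_orbit jn; have P := cp_orbit jn.
have up : rot_up j = ((j * k) %% n)%N by rewrite /rot_up -[j == 0%N]negbK -lt0n j0.
rewrite up in M.
have [jn1|jn1] := boolP (j < n.-1)%N.
  have Fy : iter j.+1 F c_m <= F y <= iter j.+1 F c_p.
    have mon (s t : R) : s <= t -> t <= y_m \/ y_p <= s -> F s <= F t.
      rewrite le_eqVlt => /predU1P[->//|st] [] H.
        by have /andP[/ltW] := F_inc1 st H.
      by have /andP[/ltW] := F_inc3 H st.
    have := rot_neq_central k_gt0 k_lt_n k_n jn1; rewrite neq_ltn => /orP[] L.
      by have g := grid_left L; rewrite !iterS !mon //; (try left); lra.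
    by have g := grid_right L; rewrite !iterS !mon //; (try right); lra.
  have jSn : (j.+1 < n)%N by rewrite -(prednK n_gt0) ltnS.
  have avF : avoids (F y) by move=> i; rewrite -iterSr; exact: av.
  have jd' : (n - j.+1 < d)%N by rewrite subnSK // -ltnS.
  have [m [a [an H]]] := IH j.+1 (F y) isT jSn jd' avF Fy.
  by exists m.+1, a; rewrite iterSr.
have jE : j = n.-1 by apply/eqP; rewrite eqn_leq [(n.-1 <= j)%N]leqNgt jn1 andbT -ltnS prednK.
move: yj; rewrite jE => /andP[My yP].
have loE : lo (n - k) = iter n.-1 F c_p by rewrite /lo rot_inv_central.
have nkS : ((n - k).-1.+1 = n - k)%N by rewrite prednK // subn_gt0.
have nk1 : ((n - k).-1 < n)%N by exact: leq_ltn_trans (leq_pred _) nk_lt_n.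
have hiE : hi (n - k).-1 = iter n.-1 F c_m by rewrite /hi nkS modn_small // rot_inv_central.
have [yp|yp] := leP y_p y.
  exists 1%N, 0%N; split => //=.
  have := arc_step nk_lt_n (arc_lo nk_lt_n); rewrite subnK ?(ltnW k_lt_n) // modnn => A0.
  have A1 : arc 0 c_p by have := arc_lo n_gt0; rewrite /lo rot_inv0.
  apply: (arc_convex A1 A0); apply/andP; split.
    move: yp; rewrite le_eqVlt => /predU1P[<-//|yp].
    by have /andP[/ltW] := F_inc3 (lexx _) yp.
  move: yP; rewrite -loE le_eqVlt => /predU1P[<-//|yP].
  by have /andP[/ltW] := F_inc3 yp yP.
have ym : y <= y_m by rewrite leNgt; apply/negP => ?; apply: (av 0%N); rewrite /=; lra.
have n1n : (n.-1 < n)%N by rewrite prednK.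
exists 1%N, n.-1; split => //=.
have := arc_step nk1 (arc_hi nk1); rewrite (_ : ((n - k).-1 + k = n.-1)%N); last first.
  by apply: succn_inj; rewrite -addSn nkS prednK // subnK // ltnW.
rewrite modn_small // => A0.
have A1 : arc n.-1 c_m by have := arc_hi n1n; rewrite /hi prednK // modnn rot_inv0.
apply: (arc_convex A0 A1); apply/andP; split.
  move: My; rewrite -hiE le_eqVlt => /predU1P[->//|My].
  by have /andP[/ltW] := F_inc1 My ym.
move: ym; rewrite le_eqVlt => /predU1P[->//|ym].
by have /andP[/ltW] := F_inc1 ym (lexx _).
Qed.

Lemma in_cell m y : (0 < m)%N -> grid 0 <= y <= grid m ->
  exists2 a, (a < m)%N & grid a <= y <= grid a.+1.
Proof.
case: m => // m _; elim: m => [|m IH] ym; first by exists 0%N.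
have [H|H] := leP y (grid m.+1).
  by have [|a am ya] := IH; [rewrite H andbT; case/andP: ym|exists a => //; apply: ltnW].
by exists m.+1 => //; rewrite ltW //=; case/andP: ym.
Qed.

Lemma avoiding_converges z y : arc (n - k) z -> iter n F z = z -> avoids y ->
  converges_to_orbit F z n y.
Proof.
move=> az Hz avy; have [m ym] := orbit_enters_core y.
suff [m' [a [an H]]] : exists m' a, (a < n)%N /\ arc a (iter m' F (iter m F y)).
  apply: (@converges_to_orbit_iter _ _ m).
  by apply: (@converges_to_orbit_iter _ _ m'); exact: (arc_converges az Hz an H).
have av : avoids (iter m F y) by move=> j; rewrite -iterD; exact: avy.
move: (iter m F y) ym av => {avy}{}y yc av.
have [h0 nuE ? ? [? ? ? ? ?]] := numerics.
have cp := cp_bounds; have cm := cm_bounds; have ym0 := ym_lt0; have yp0 := yp_gt0.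
have [|a an ya] := @in_cell n y n_gt0; first by rewrite grid0 grid_n; lra.
have [yl|yl] := ltP y (lo a).
  have J0 : (0 < rot_inv k n a)%N.
    by rewrite lt0n; apply/eqP => E; move: yl; rewrite /lo E /=; lra.
  apply: (gap_enters_arc J0) => //; first exact: rot_inv_lt.
  apply/andP; split; last exact: ltW yl.
  have := cm_orbit (rot_inv_lt k_lt_n a).
  rewrite /rot_up -[_ == 0%N]negbK -lt0n J0 /= rot_invK //; lra.
have [yh|yh] := ltP (hi a) y; last by exists 0%N, a; split => //; rewrite /arc yl.
pose j := rot_inv k n (a.+1 %% n).
have J0 : (0 < j)%N.
  by rewrite lt0n; apply/eqP => E; move: yh; rewrite /hi -/j E /=; lra.
have aSn : (a.+1 < n)%N.
  rewrite ltn_neqAle an andbT; apply/eqP => E.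
  by move: J0; rewrite /j E modnn rot_inv0.
apply: (gap_enters_arc J0) => //; first exact: rot_inv_lt.
apply/andP; split; first exact: ltW yh.
have := cp_orbit (rot_inv_lt k_lt_n (a.+1 %% n)).
by rewrite rot_invK ?ltn_pmod // -/j (modn_small aSn); lra.
Qed.

Lemma arc_first x : c_p <= x <= b - 1 + h -> arc 0 x.
Proof.
have [h0 nuE ? ? [? ? ? ? ?]] := numerics.
have := hi_bounds n_gt0; rewrite gridS grid0 /arc => H.
by rewrite [lo 0]/lo rot_inv0 /=; lra.
Qed.

Lemma arc_last x : b - h <= x <= c_m -> arc n.-1 x.
Proof.
have [h0 nuE ? ? [? ? ? ? ?]] := numerics.
have n1n : (n.-1 < n)%N by rewrite prednK.
have := lo_bounds n1n; have := grid_n; rewrite -{1}(prednK n_gt0) gridS /arc => g H.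
by rewrite [hi n.-1]/hi prednK // modnn rot_inv0 /=; lra.
Qed.

Lemma exists_escaping_ends : (forall x y, y_m <= x -> x < y -> y <= y_p -> F y < F x) ->
  exists u_m u_p, [/\ y_m < u_m, u_m < u_p, u_p < y_p,
    forall x, y_m <= x <= u_m -> forall j, (0 < j)%N -> ~ (y_m <= iter j F x <= y_p) &
    forall x, u_p <= x <= y_p -> forall j, (0 < j)%N -> ~ (y_m <= iter j F x <= y_p)].
Proof.
move=> F_dec2.
have [h0 nuE ? ? [? ? ? ? ymyp]] := numerics.
have cp := cp_bounds; have cm := cm_bounds; have ym0 := ym_lt0; have yp0 := yp_gt0.
have dec x y : y_m <= x -> x <= y -> y <= y_p -> F y <= F x.
  move=> mx; rewrite le_eqVlt => /predU1P[->//|xy] yp; apply/ltW/F_dec2 => //.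
have [u_p up Eup] : exists2 u, y_m <= u <= y_p & F u = b - 1 + h.
  by apply: ivt_dec => //; [exact: ltW|rewrite -/c_m -/c_p; lra].
have [u_m um Eum] : exists2 u, y_m <= u <= y_p & F u = b - h.
  by apply: ivt_dec => //; [exact: ltW|rewrite -/c_m -/c_p; lra].
have neqF s t : F s < F t -> s != t by move=> H; apply/eqP => E; rewrite E ltxx in H.
have mum : y_m < u_m by rewrite lt_neqAle eq_sym neqF ?Eum -/c_m; lra.
have upp : u_p < y_p by rewrite lt_neqAle eq_sym neqF ?Eup -/c_p; lra.
have umup : u_m < u_p.
  rewrite ltNge; apply/negP => H; have := dec _ _ _ H; rewrite Eum Eup; lra.
exists u_m, u_p; split => // x xu [//|j] _; rewrite iterSr.
  apply: (@arc_avoids n.-1); first by rewrite prednK.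
  apply: arc_last; rewrite -Eum !dec //; lra.
apply: (@arc_avoids 0) => //.
by apply: arc_first; rewrite -Eup !dec //; lra.
Qed.

Lemma arc_lt a a' x y : (a < a')%N -> (a' < n)%N -> arc a x -> arc a' y -> x < y.
Proof.
move=> aa a'n ax ay; have an := ltn_trans aa a'n.
have ym0 := ym_lt0; have yp0 := yp_gt0.
have := hi_bounds an; have := lo_bounds a'n; have := grid_le aa.
by move: ax ay; rewrite /arc; lra.
Qed.

Lemma arc_range a x : (a < n)%N -> arc a x -> b - 1 < x < b.
Proof.
move=> an ax; have ym0 := ym_lt0; have yp0 := yp_gt0.
have := hi_bounds an; have := lo_bounds an; have := grid_le an; have := grid_le (leq0n a).
by move: ax; rewrite /arc grid_n grid0; lra.
Qed.

Lemma arc_laps a x : (a < n)%N -> arc a x -> x < y_m \/ y_p < x.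
Proof.
move=> an ax; have [L|L] := ltnP a (n - k); first by left; exact: arc_left ax.
by right; apply: (arc_right _ ax); rewrite L.
Qed.

Let rotG a : (a < n)%N -> Gmap b (grid a + h) = grid ((a + k) %% n) + h.
Proof.
have [h0 nuE ? ? _] := numerics.
move=> an; rewrite -rot_step_mod // /Gmap; have [L|L] := ltnP a (n - k).
  have g := grid_left L; rewrite grid_step_left //.
  by rewrite (_ : grid a + h < 0); [ring|lra].
have := grid_le L; rewrite grid_central => g; rewrite grid_step_right //.
rewrite (_ : grid a + h < 0 = false); last by apply/negbTE; rewrite -leNgt; lra.
by rewrite (_ : 0 < grid a + h); [ring|lra].
Qed.

Lemma iter_Gmap j : iter j (Gmap b) h = grid ((n - k + j * k) %% n) + h.
Proof.
elim: j => [|j IH]; first by rewrite mul0n addn0 modn_small // grid_central add0r.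
by rewrite iterS IH rotG ?ltn_pmod // modnDml mulSnr addnA.
Qed.

Lemma periodic_cyclic_order z i j l : arc (n - k) z ->
  (i < n)%N -> (j < n)%N -> (l < n)%N ->
  ccw (circ b (iter i F z)) (circ b (iter j F z)) (circ b (iter l F z)) =
  ccw (circ b (iter i (Gmap b) h)) (circ b (iter j (Gmap b) h)) (circ b (iter l (Gmap b) h)).
Proof.
move=> az i_n j_n l_n.
pose a m := ((n - k + m * k) %% n)%N.
have an m : (a m < n)%N by rewrite ltn_pmod.
have aF m : arc (a m) (iter m F z) by exact: arc_iter.
have [h0 nuE ? ? _] := numerics.
have cF m : circ b (iter m F z) = iter m F z.
  by rewrite /circ lt_eqF //; have /andP[] := arc_range (an m) (aF m).
have cG m : circ b (iter m (Gmap b) h) = grid (a m) + h.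
  rewrite iter_Gmap -/(a m) /circ lt_eqF //.
  have := grid_le (an m); rewrite gridS grid_n; lra.
have a_inj m m' : (m < n)%N -> (m' < n)%N -> a m = a m' -> m = m'.
  move=> m_n m'_n /eqP; rewrite /a eqn_modDl => /eqP.
  exact: (rot_inj k_gt0 k_n).
have ordF m m' : (m < n)%N -> (m' < n)%N -> (iter m F z < iter m' F z) = (a m < a m')%N.
  move=> m_n m'_n; case: (ltngtP (a m) (a m')) => H.
  - by apply: arc_lt H _ _ _.
  - by apply/negbTE; rewrite -leNgt ltW //; apply: arc_lt H _ _ _.
  - by rewrite (a_inj _ _ m_n m'_n H) ltxx.
have ordG m m' : (grid (a m) + h < grid (a m') + h) = (a m < a m')%N.
  by rewrite ltrD2r /grid ltrD2l ltr_pM2r // ltr_nat.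
by rewrite /ccw !cF !cG !ordF // !ordG.
Qed.

Lemma periodic_neq z j : arc (n - k) z -> (0 < j)%N -> (j < n)%N -> iter j F z != z.
Proof.
move=> az j0 jn; have aj := arc_iter j nk_lt_n az.
have an : ((n - k + j * k) %% n < n)%N by rewrite ltn_pmod.
have : ((n - k + j * k) %% n != n - k)%N.
  rewrite -{2}(modn_small nk_lt_n) -{2}[(n - k)%N]addn0 eqn_modDl mod0n.
  exact: (rot_neq0 k_gt0 k_lt_n k_n).
rewrite neq_ltn => /orP[] H.
  by rewrite lt_eqF // (arc_lt H nk_lt_n aj az).
by rewrite gt_eqF // (arc_lt H an az aj).
Qed.

End RotationLikeDynamics.

(** * Smoothness of the map and of its iterates *)

Section SmoothMaps.
Context {R : realType}.

Lemma is_derive_derive1 (f : R -> R) (x : R) : derivable f x 1 -> is_derive x 1 f (derive1 f x).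
Proof. by move=> df; rewrite derive1E; exact: derivableP. Qed.

Lemma is_derive_Fmap (b : R) (g : R -> R) (x : R) : derivable g x 1 ->
  is_derive x 1 (Fmap b g) (1 - derive1 g x).
Proof.
move=> dg; have D := is_deriveB (is_deriveD (is_derive_id x 1) (is_derive_cst b x 1)) (is_derive_derive1 dg).
by apply: (is_derive_eq D); rewrite addr0.
Qed.

Lemma derive1_Fmap (b : R) (g : R -> R) : (forall x : R, derivable g x 1) ->
  derive1 (Fmap b g) = fun x => 1 - derive1 g x.
Proof.
by move=> dg; apply/funext => x; rewrite derive1E; have [_ ->] := is_derive_Fmap b (dg x).
Qed.

Lemma Fmap_C3 (b : R) (g : R -> R) (x : R) : C3 g ->
  [/\ is_derive x 1 (Fmap b g) (derive1 (Fmap b g) x),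
      is_derive x 1 (derive1 (Fmap b g)) (derive1n 2 (Fmap b g) x) &
      is_derive x 1 (derive1n 2 (Fmap b g)) (derive1n 3 (Fmap b g) x)].
Proof.
move=> [dg _]; have dg0 (y : R) : derivable g y 1 by have [] := dg y.
have dg1 (y : R) : derivable (derive1 g) y 1 by have [] := dg y.
have dg2 (y : R) : derivable (derive1n 2 g) y 1 by have [] := dg y.
have E1 := derive1_Fmap b dg0.
have D1 (y : R) : is_derive y 1 (derive1 (Fmap b g)) (- derive1n 2 g y).
  rewrite E1; have D := is_deriveB (is_derive_cst (1 : R) y 1) (is_derive_derive1 (dg1 y)).
  by apply: (is_derive_eq D); rewrite sub0r.
have E2 : derive1n 2 (Fmap b g) = fun y => - derive1n 2 g y.
  by apply/funext => y; rewrite [LHS]derive1E; have [_ ->] := D1 y.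
split.
- by apply: is_derive_derive1; have [] := is_derive_Fmap b (dg0 x).
- by apply: is_derive_derive1; have [] := D1 x.
- apply: is_derive_derive1; rewrite E2.
  by have [] := is_deriveN (is_derive_derive1 (dg2 x)).
Qed.

Lemma Fmap_expands_cross_ratio_inc (b : R) (g : R -> R) (a c : R) : C3 g ->
  (forall x, derive1 (Fmap b g) x != 0 -> schwarzian (Fmap b g) x < 0) ->
  (forall x, a <= x <= c -> 0 < derive1 (Fmap b g) x) ->
  expands_cross_ratio (Fmap b g) a c.
Proof.
move=> gC3; move: (fun x => @Fmap_C3 b g x gC3).
rewrite /schwarzian; move: (Fmap b g) => F FD SF pos.
have D0 x : a <= x <= c -> is_derive x 1 F (derive1 F x) by have [] := FD x.
have D1 x : a <= x <= c -> is_derive x 1 (derive1 F) (derive1n 2 F x) by have [] := FD x.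
have D2 x : a <= x <= c -> is_derive x 1 (derive1n 2 F) (derive1n 3 F x) by have [] := FD x.
have S x : a <= x <= c -> derive1n 3 F x / derive1 F x - 3%:R / 2%:R * (derive1n 2 F x / derive1 F x) ^+ 2 <= 0.
  by move=> /pos xp; apply/ltW/SF; rewrite gt_eqF.
exact: (schwarzian_le0_expands_cross_ratio D0 D1 D2 pos S).
Qed.

Lemma Fmap_expands_cross_ratio_dec (b : R) (g : R -> R) (a c : R) : C3 g ->
  (forall x, derive1 (Fmap b g) x != 0 -> schwarzian (Fmap b g) x < 0) ->
  (forall x, a <= x <= c -> derive1 (Fmap b g) x < 0) ->
  expands_cross_ratio (Fmap b g) a c.
Proof.
move=> gC3; move: (fun x => @Fmap_C3 b g x gC3).
rewrite /schwarzian; move: (Fmap b g) => F FD SF neg; apply: expands_cross_ratio_opp.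
have D0 x : a <= x <= c -> is_derive x 1 (- F) (- derive1 F x).
  by have [? _ _] := FD x; move=> _; exact: is_deriveN.
have D1 x : a <= x <= c -> is_derive x 1 (- derive1 F) (- derive1n 2 F x).
  by have [_ ? _] := FD x; move=> _; exact: is_deriveN.
have D2 x : a <= x <= c -> is_derive x 1 (- derive1n 2 F) (- derive1n 3 F x).
  by have [_ _ ?] := FD x; move=> _; exact: is_deriveN.
have pos x : a <= x <= c -> 0 < - derive1 F x by rewrite oppr_gt0; exact: neg.
have S x : a <= x <= c -> - derive1n 3 F x / - derive1 F x -
    3%:R / 2%:R * (- derive1n 2 F x / - derive1 F x) ^+ 2 <= 0.
  by move=> /neg xn; rewrite !invrN !mulrNN; apply/ltW/SF; rewrite lt_eqF.
exact: (schwarzian_le0_expands_cross_ratio D0 D1 D2 pos S).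
Qed.

Lemma is_derive_iter (f df : R -> R) (z : R) m :
  (forall j, (j < m)%N -> is_derive (iter j f z) 1 f (df (iter j f z))) ->
  (forall j, (j < m)%N -> 0 < df (iter j f z) < 1) ->
  exists2 d, is_derive z 1 (iter m f) d & 0 < d <= 1 /\ ((0 < m)%N -> d < 1).
Proof.
elim: m => [|m IH] fD f01; first by exists 1; [exact: is_derive_id|rewrite ltr01 lexx].
have [||d Dd [d01 _]] := IH; [by move=> j jm; apply: fD; exact: ltnW|by move=> j jm; apply: f01; exact: ltnW|].
exists (df (iter m f z) * d).
  by rewrite (_ : iter m.+1 f = f \o iter m f) //; apply: is_derive1_comp; exact: fD.
have /andP[p1 p2] := f01 m (ltnSn m); have /andP[q1 q2] := d01.
have H : df (iter m f z) * d < 1.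
  by rewrite (le_lt_trans _ p2) // ler_piMr // ltW.
by rewrite mulr_gt0 // ltW.
Qed.

End SmoothMaps.

Theorem theorem3p3 (R : realType) (k n : nat) (g : R -> R) (y_m y_p eps : R) :
  (0 < k)%N -> (k < n)%N -> coprime k n ->
  let b : R := k%:R / n%:R in
  let F := Fmap b g in
  (* g : R -> (0,1), of class C^3 *)
  (forall x, 0 < g x < 1) -> C3 g ->
  (* negative Schwarzian derivative of F wherever defined *)
  (forall x, derive1 F x != 0 -> schwarzian F x < 0) ->
  (* (A) *)
  b - 1 < y_m -> y_m < 0 -> 0 < y_p -> y_p < b ->
  (forall x, (x < y_m \/ y_p < x) -> 0 < derive1 g x < 1) ->
  derive1 g y_m = 1 -> derive1 g y_p = 1 ->
  (forall x, y_m < x < y_p -> 1 < derive1 g x) ->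
  (* (B) *)
  g (b - 1) < b -> b < g b ->
  (* (C) *)
  0 < eps ->
  (forall x, x < - (1 / (2 * n%:R)) -> g x < eps) ->
  (forall x, 1 / (2 * n%:R) < x -> 1 - eps < g x) ->
  (n.-1)%:R * eps < 1 - g y_p ->
  (n.-1)%:R * eps < 1 / (2 * n%:R) - (1 - g y_p + y_p) ->
  (n.-1)%:R * eps < g y_m ->
  (n.-1)%:R * eps < 1 / (2 * n%:R) - (g y_m - y_m) ->
  exists z : R,
    (* periodic of (minimal) period n *)
    [/\ iter n F z = z /\
        (forall j : nat, (0 < j)%N -> (j < n)%N -> iter j F z != z),
    (* attracting: multiplier of modulus < 1 *)
        derivable (iter n F) z 1 /\ `|derive1 (iter n F) z| < 1,
    (* (i) Lebesgue-a.e. trajectory converges to the orbit *)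
        {ae (@lebesgue_measure R), forall x : R, converges_to_orbit F z n x},
    (* (ii) orbit in [b-1,b], in the first or third lap *)
        (forall j : nat, (j < n)%N ->
           b - 1 <= iter j F z <= b /\ (iter j F z < y_m \/ y_p < iter j F z)) &
    (* (iii) same cyclic order as an orbit of G on the circle [b-1,b]/(b-1 ~ b) *)
        exists w : R, b - 1 <= w <= b /\
          forall i j l : nat, (i < n)%N -> (j < n)%N -> (l < n)%N ->
            ccw (circ b (iter i F z)) (circ b (iter j F z)) (circ b (iter l F z))
            = ccw (circ b (iter i (Gmap b) w)) (circ b (iter j (Gmap b) w))
                  (circ b (iter l (Gmap b) w))].
Proof.
move=> k0 kn cop b F g01 gC3 SF ym1 ym0 yp0 yp1 gL gym gyp gM gb1 gb e0 C1 C2 C3a C3b C4a C4b.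
have n0 : (0 < n)%N by exact: leq_ltn_trans kn.
have hE : 1 / (2 * n%:R) = n%:R^-1 / 2 :> R.
  by field; rewrite pnatr_eq0 -lt0n.
rewrite hE in C1 C2 C3b C4b; set h := n%:R^-1 / 2 in C1 C2 C3b C4b.
have dg (x : R) : derivable g x 1 by case: gC3 => /(_ x)[].
have FD (x : R) : is_derive x 1 F (derive1 F x) by have [] := Fmap_C3 b x gC3.
have FE x : derive1 F x = 1 - derive1 g x by rewrite /F derive1_Fmap.
have F_cont : continuous F.
  by move=> x; apply/differentiable_continuous/derivable1_diffP; have [] := FD x.
have mvt x y : x < y -> exists2 c, x < c < y & F y - F x = derive1 F c * (y - x).
  move=> xy; have [c] := MVT xy (fun t _ => FD t) (continuous_subspaceT F_cont).
  by rewrite in_itv /= => cxy E; exists c.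
have F_con x y : x < y -> y <= y_m \/ y_p <= x -> F x < F y < F x + (y - x).
  move=> xy H; have [c cxy E] := mvt x y xy.
  have /andP[c0 c1] : 0 < derive1 g c < 1 by apply: gL; case: H => ?; [left|right]; lra.
  rewrite -subr_gt0 -(subr_gt0 (F y)).
  have -> : F x + (y - x) - F y = (y - x) - (F y - F x) by ring.
  rewrite E FE (_ : y - x - _ = derive1 g c * (y - x)); last by ring.
  by rewrite !mulr_gt0 // subr_gt0.
have F_inc1 x y : x < y -> y <= y_m -> F x < F y < F x + (y - x) by move=> xy H; apply: F_con => //; left.
have F_inc3 x y : y_p <= x -> x < y -> F x < F y < F x + (y - x) by move=> H xy; apply: F_con => //; right.
have F_dec2 x y : y_m <= x -> x < y -> y <= y_p -> F y < F x.
  move=> mx xy yp; have [c cxy E] := mvt x y xy.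
  have c1 : 1 < derive1 g c by apply: gM; lra.
  by rewrite -subr_lt0 E FE pmulr_llt0 ?subr_gt0 // subr_lt0.
have F_left (x : R) : x < - h -> x + b - eps <= F x <= x + b.
  by move=> /C1; have := g01 x; rewrite /F /Fmap; lra.
have F_right x : h < x -> x + b - 1 <= F x <= x + b - 1 + eps.
  by move=> /C2; have := g01 x; rewrite /F /Fmap; lra.
have cp : b - 1 + y_p + n.-1%:R * eps < F y_p < b - 1 + h - n.-1%:R * eps.
  by rewrite /F /Fmap; lra.
have cm : b - h + n.-1%:R * eps < F y_m < b + y_m - n.-1%:R * eps.
  by rewrite /F /Fmap; lra.
have nk : (n - k < n)%N by rewrite ltn_subrL k0.
have [z az Hz] := exists_periodic k0 kn cop F_cont F_left F_right e0 ym0 yp0 cp cm F_inc1 F_inc3.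
have arcj j := arc_iter k0 kn cop F_left F_right e0 ym0 yp0 cp cm F_inc1 F_inc3 j nk az.
have aj j : ((n - k + j * k) %% n < n)%N by rewrite ltn_pmod.
have lap j := arc_laps k0 kn cop F_left F_right e0 ym0 yp0 cp cm (aj j) (arcj j).
exists z; split.
- split => // j j0 jn.
  exact: (periodic_neq k0 kn cop F_left F_right e0 ym0 yp0 cp cm F_inc1 F_inc3 az).
- have F01 j : (j < n)%N -> 0 < derive1 F (iter j F z) < 1.
    by move=> _; have := gL _ (lap j); rewrite FE; lra.
  have [d Dd [d01 d1]] := is_derive_iter (fun j _ => FD (iter j F z)) F01.
  split; first by have [] := Dd.
  by rewrite derive1E; have [_ ->] := Dd; rewrite gtr0_norm; [exact: d1|lra].
- have [u_m [u_p [um umup up nl nr]]] :=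
    exists_escaping_ends k0 kn cop F_cont F_left F_right e0 ym0 yp0 cp cm F_inc1 F_inc3 F_dec2.
  have null : (@lebesgue_measure R).-negligible (recurrent F y_m y_p).
    apply: (@recurrent_negligible R F y_m y_p u_m u_p F_cont _ F_dec2 _ _ _ _ _ _ um umup up nl nr).
    + by move=> x y xy ym; have /andP[] := F_inc1 x y xy ym.
    + by move=> x y px xy; have /andP[] := F_inc3 x y px xy.
    + move=> a c cy; apply: Fmap_expands_cross_ratio_inc => // x xac.
      have : 0 < derive1 g x < 1 by apply: gL; left; lra.
      by rewrite FE; lra.
    + move=> a c ya cy; apply: Fmap_expands_cross_ratio_dec => // x xac.
      have : 1 < derive1 g x by apply: gM; lra.
      by rewrite FE; lra.
    + move=> a c ya; apply: Fmap_expands_cross_ratio_inc => // x xac.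
      have : 0 < derive1 g x < 1 by apply: gL; right; lra.
      by rewrite FE; lra.
    + move=> x v; have [t tx tv] : exists2 t, t <= x & t <= v - b.
        by exists (Num.min x (v - b)); rewrite ge_min lexx ?orbT.
      by exists t => //; have := g01 t; rewrite /F /Fmap; lra.
    + move=> x v; have [t tx tv] : exists2 t, x <= t & v - b + 1 <= t.
        by exists (Num.max x (v - b + 1)); rewrite le_max lexx ?orbT.
      by exists t => //; have := g01 t; rewrite /F /Fmap; lra.
  apply: negligibleS null => x /= nconv; apply: contrapT => nrec; apply: nconv.
  have [m Hm] : exists m, forall j, (m <= j)%N -> ~ (y_m < iter j F x < y_p).
    apply: contrapT => /forallNP H; apply: nrec => m.
    have /existsNP[j /not_implyP[mj /contrapT jJ]] := H m.
    by exists j.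
  apply: (@converges_to_orbit_iter R n F z x m).
  apply: (avoiding_converges k0 kn cop F_cont F_left F_right e0 ym0 yp0 cp cm F_inc1 F_inc3 az Hz).
  by move=> j; rewrite -iterD; apply: Hm; rewrite leq_addl.
- move=> j jn; split; last exact: lap.
  have := arc_range k0 kn cop F_left F_right e0 ym0 yp0 cp cm (aj j) (arcj j).
  by rewrite -/b; lra.
- exists h; split.
    have nu0 : 0 < n%:R^-1 :> R by rewrite invr_gt0 ltr0n.
    have : n%:R^-1 <= b by rewrite /b ler_peMl ?(ltW nu0) // ler1n.
    by rewrite /h; lra.
  move=> i j l i_n j_n l_n.
  exact: (periodic_cyclic_order k0 kn cop F_left F_right e0 ym0 yp0 cp cm F_inc1 F_inc3 az).
Qed.
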